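(* Assume that the random variable $\xi_0$ satisfies $\|\xi_0\|_p<\infty$ for some $p>2$ and that $\rho_n^2\to 0$ as $n\to\infty$. Then for every sequence $(x_n)$ of real numbers with $x_n\ge 0$ and $x_n^2\le 2\ln (U_{np}^{-1})$, one has $$\mathbb{P}\left(S_n\ge x_n\sigma_n\right)=(1-\Phi(x_n))(1+o(1))\quad\text{as } n\to\infty$$ and $$\mathbb{P}\left(S_n\le -x_n\sigma_n\right)=(1-\Phi(x_n))(1+o(1))\quad\text{as } n\to\infty.$$
   Context: Let $\{a_{r,s}\}_{(r,s)\in\mathbb{Z}^2}$ be a square summable family of real constants and let $\{\xi_{r,s}\}_{(r,s)\in\mathbb{Z}^2}$ and $\xi_0$ be i.i.d. real random variables on a probability space $(\Omega,\mathcal F,\mathbb P)$ with $\mathbb{E}\xi_0=0$ and $\mathbb{E}\xi_0^2=1$. The linear random field is $X_{j,k}=\sum_{r,s\in\mathbb{Z}}a_{r,s}\xi_{j-r,k-s}$, $(j,k)\in\mathbb{Z}^2$ (the series converges in $L^2(\Omega,\mathbb P)$ and almost surely). Let $(\Gamma_n)_{n\ge1}$ be a sequence of finite subsets of $\mathbb{Z}^2$ and $$S_n=\sum_{(j,k)\in\Gamma_n}X_{j,k}=\sum_{r,s\in\mathbb{Z}}b_{n,r,s}\xi_{-r,-s},\qquad b_{n,r,s}=\sum_{(j,k)\in\Gamma_n}a_{j+r,k+s}.$$ For $t\ge 2$ put $D_{nt}=\sum_{r,s\in\mathbb{Z}}|b_{n,r,s}|^t$ and $U_{nt}=(D_{n2})^{-t/2}D_{nt}$.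 Put $\sigma_n^2=\mathbb{E}S_n^2=D_{n2}$, with $\sigma_n>0$ assumed for every $n$, and $\rho_n^2=\max_{r,s\in\mathbb{Z}}b_{n,r,s}^2/\sigma_n^2$. $\|\xi\|_p$ denotes the $L^p(\mathbb P)$-norm and $\Phi$ is the standard normal distribution function. *)

(* Defs.v *)
From HB Require Import structures.
From mathcomp Require Import all_boot all_order all_algebra finmap.
From mathcomp Require Import all_classical all_reals all_analysis.
From mathcomp.analysis.showcase Require summability.
Import Order.TTheory GRing.Theory Num.Theory.
Import numFieldNormedType.Exports.

Set Implicit Arguments.
Unset Strict Implicit.
Unset Printing Implicit Defensive.

Local Open Scope classical_set_scope.
Local Open Scope ring_scope.

Notation Z2 := (int * int)%type.

Section iid.
Context (d : measure_display) (T : measurableType d) (R : realType)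
  (P : probability T R) (I : choiceType).

Definition mutually_independent (X : I -> {RV P >-> R}) : Prop :=
  forall (F : {fset I}) (B : I -> set R),
    (forall i, i \in F -> measurable (B i)) ->
    P (\bigcap_(i in [set` F]) (X i @^-1` B i)) =
    (\prod_(i <- F) P (X i @^-1` B i))%E.

Definition identically_distributed (X : I -> {RV P >-> R}) : Prop :=
  forall (i j : I) (B : set R), measurable B ->
    distribution P (X i) B = distribution P (X j) B.

Definition iid (X : I -> {RV P >-> R}) : Prop :=
  mutually_independent X /\ identically_distributed X.

End iid.

Section linear_field.
Context (d : measure_display) (T : measurableType d) (R : realType)
  (P : probability T R).

(* X u = \sum_v a v * xi (u - v), the series over Z2 being summed in L^2 along
   the directed set of finite subsets of Z2, i.e. unconditionally; this
   determines each X u up to almost sure equality. *)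
Definition linear_random_field (a : Z2 -> R) (xi X : Z2 -> {RV P >-> R}) : Prop :=
  forall u : Z2,
    (fun F : {fset Z2} => ('N[P]_(2%:E) [ EFin \o
       (fun w => X u w - \sum_(v <- F) a v * xi (u - v) w)%R ])%E)
      @ summability.totally --> 0%E.

Definition field_sum (X : Z2 -> {RV P >-> R}) (Gamma : {fset Z2}) (w : T) : R :=
  \sum_(u <- Gamma) X u w.

Definition sigma2 (X : Z2 -> {RV P >-> R}) (Gamma : {fset Z2}) : R :=
  fine ('E_P[(fun w => field_sum X Gamma w ^+ 2)%R])%E.

Definition sigma (X : Z2 -> {RV P >-> R}) (Gamma : {fset Z2}) : R :=
  Num.sqrt (sigma2 X Gamma).

End linear_field.

Section coefficients.
Context (R : realType).
Implicit Types (a : Z2 -> R) (Gamma : {fset Z2}).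

Definition coef_b a Gamma (v : Z2) : R := \sum_(u <- Gamma) a (u + v).

(* The sum is finite when a is square summable and t >= 2, so that fine loses
   no information. *)
Definition D a Gamma (t : R) : R :=
  fine (\esum_(v in [set: Z2]) (`|coef_b a Gamma v| `^ t)%:E).

Definition U a Gamma (t : R) : R := D a Gamma 2 `^ (- (t / 2)) * D a Gamma t.

(* The supremum is a maximum when a is square summable, since then coef_b tends
   to 0 at infinity. *)
Definition rho2 a Gamma (s2 : R) : R :=
  sup [set coef_b a Gamma v ^+ 2 / s2 | v in [set: Z2]].

End coefficients.

Definition Phi (R : realType) (x : R) : R :=
  fine (normal_prob 0 1 `]-oo, x]).

(* Main.v *)
(* Lindeberg's replacement method with exponential weights.  Put
   m = sqrt (2 ln (1 / U)), so that U = exp (- m^2 / 2) and |x| <= m.  Up to an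
   L2-error as small as we like, S / sigma is a finite sum of independent
   Y_v = (b_v / sigma) xi_{-v}.  Truncating the Y_v at m / 4 changes the sum with
   probability O(m^-p U), which is negligible against 1 - Phi(x), because
   1 - Phi(x) >= c exp (- x^2 / 2) / m and p > 1; it also keeps the exponential
   moments E exp (x |Y_v|) below U^(-1/2).  The indicator of [x, oo) is smoothed
   by a Gaussian of variance m^-8 and the summands are replaced one at a time by
   Gaussians.  Since the smoothed indicator solves the heat equation, only third
   order terms remain; they are bounded by m^k exp (- x^2 / 2) times the sum of
   E |Y_v|^3 exp (m |Y_v|), the factor exp (- x^2 / 2) coming from the tilt
   exp (x s) of the derivative bounds.  That sum decays like exp (- c m^2), which
   beats every power of m.  Hence P (S >= x sigma) = 1 - Phi(x) +
   O(m^-2 exp (- x^2 / 2)), a relative error O(1 / m). *)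

Require Import Defs.

From mathcomp Require Import all_boot all_order all_algebra finmap.
From mathcomp Require Import all_classical all_reals all_analysis.
From mathcomp Require Import measurable_realfun ring lra.
Import Order.TTheory GRing.Theory Num.Theory.
Import numFieldNormedType.Exports.

Local Open Scope classical_set_scope.
Local Open Scope ring_scope.

Set Implicit Arguments.
Unset Strict Implicit.
Unset Printing Implicit Defensive.

(** * Taylor estimates *)

(** The tail to be approximated can be nearly as small as [U], so an absolute error bound of
    Berry-Esseen type is useless: every error has to carry the factor [expR (- x ^+ 2 / 2)]. No
    conjugate measure is introduced for this. The tilt enters only as a pointwise weight in the
    bounds on the heat kernel, and it is integrated afterwards with the moment generating function
    of the truncated partial sums. Errors that are probabilities carry the factor [U] instead, and
    [U <= expR (- x ^+ 2 / 2)] because [|x| <= m]; this is why all scales are powers of [m] and not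
    of [x], which may stay bounded. Truncated variables are not recentred: the defects of their mean
    and variance are charged to the same error term as the weighted third moment. The comparison
    Gaussian only needs a variance within [m ^- 8] of 1, so a finite part of the series suffices.
    Both tails are handled at once by a factor [sg] of modulus 1, which disappears from all moments
    that matter. *)

Lemma mvt_normr_le (R : realType) (g g1 : R -> R) (C a b : R) : a <= b ->
  (forall x, a <= x <= b -> is_derive x 1 g (g1 x)) ->
  (forall x, a <= x <= b -> `|g1 x| <= C) -> `|g b - g a| <= C * (b - a).
Proof.
move=> ab dg bg.
have dg' x : x \in `]a, b[%R -> is_derive x 1 g (g1 x).
  by rewrite in_itv/= => /andP[/ltW ax /ltW xb]; apply: dg; rewrite ax xb.
have cg : {within `[a, b], continuous g}.
  apply: derivable_within_continuous => x; rewrite in_itv/= => xab.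
  by have [] := dg x xab.
have [x xab ->] := MVT_segment ab dg' cg.
rewrite normrM (ger0_norm (_ : 0 <= b - a)) ?subr_ge0//.
by rewrite ler_wpM2r ?subr_ge0// bg//; move: xab; rewrite in_itv.
Qed.

Lemma mvt_normr_le_sym (R : realType) (g g1 : R -> R) (C a r : R) :
  (forall x : R, is_derive x 1 g (g1 x)) ->
  (forall x, `|x - a| <= `|r| -> `|g1 x| <= C) ->
  `|g (a + r) - g a| <= C * `|r|.
Proof.
move=> dg bg; have [r0|r0] := leP 0 r.
  rewrite -[X in _ * X](_ : a + r - a = _); last by rewrite (ger0_norm r0); lra.
  apply: mvt_normr_le => [|x /andP[ax xr]]; first lra.
  by apply: bg; rewrite !ger0_norm//; lra.
rewrite distrC -[X in _ * X](_ : a - (a + r) = _); last first.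
  by rewrite (ltr0_norm r0); lra.
apply: mvt_normr_le => [|x /andP[ax xr]]; first lra.
by apply: bg; rewrite !ler0_norm//; lra.
Qed.

(** Three nested mean value inequalities, one for each derivative; the factor 1/6 of Taylor's
    formula is given up. *)
Lemma taylor2_normr_le (R : realType) (f f1 f2 f3 : R -> R) (B a r : R) :
  (forall x : R, is_derive x 1 f (f1 x)) -> (forall x : R, is_derive x 1 f1 (f2 x)) ->
  (forall x : R, is_derive x 1 f2 (f3 x)) ->
  (forall x, `|x - a| <= `|r| -> `|f3 x| <= B) ->
  `|f (a + r) - f a - r * f1 a - r ^+ 2 / 2 * f2 a| <= B * `|r| ^+ 3.
Proof.
move=> d1 d2 d3 b3.
have B0 : 0 <= B by apply: le_trans (b3 a _); rewrite // subrr normr0.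
have b2 x : `|x - a| <= `|r| -> `|f2 x - f2 a| <= B * `|r|.
  move=> xr; rewrite -{1}(subrKC a x).
  apply: le_trans (@mvt_normr_le_sym _ f2 f3 B a (x - a) d3 _) _.
    by move=> y /le_trans /(_ xr); exact: b3.
  by rewrite ler_wpM2l.
pose g x := f1 x - f1 a - f2 a * (x - a).
have dg (x : R) : is_derive x 1 g (f2 x - f2 a).
  rewrite /g; apply: is_derive_eq.
  by rewrite /GRing.scale /=; lra.
have b1 x : `|x - a| <= `|r| -> `|g x| <= B * `|r| ^+ 2.
  move=> xr; have -> : g x = g (a + (x - a)) - g a.
    by rewrite subrKC /g; lra.
  apply: le_trans (@mvt_normr_le_sym _ g _ (B * `|r|) a (x - a) dg _) _.
    by move=> y /le_trans /(_ xr); exact: b2.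
  by rewrite expr2 mulrA ler_wpM2l// mulr_ge0.
pose h x := f x - f1 a * (x - a) - f2 a * ((x - a) ^+ 2 / 2).
have dh (x : R) : is_derive x 1 h (g x).
  rewrite /h; apply: is_derive_eq.
  by rewrite /g /GRing.scale /=; lra.
have -> : f (a + r) - f a - r * f1 a - r ^+ 2 / 2 * f2 a = h (a + r) - h a.
  by rewrite /h; ring.
apply: le_trans (@mvt_normr_le_sym _ h _ (B * `|r| ^+ 2) a r dh b1) _.
by rewrite -mulrA -exprSr.
Qed.

Lemma taylor1_normr_le (R : realType) (f f1 f2 : R -> R) (C a b : R) : a <= b ->
  (forall x, a <= x <= b -> is_derive x 1 f (f1 x)) ->
  (forall x, a <= x <= b -> is_derive x 1 f1 (f2 x)) ->
  (forall x, a <= x <= b -> `|f2 x| <= C) ->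
  `|f b - f a - (b - a) * f1 a| <= C * (b - a) ^+ 2.
Proof.
move=> ab d1 d2 b2.
have b1 x : a <= x <= b -> `|f1 x - f1 a| <= C * (b - a).
  move=> /andP[ax xb].
  have C0 : 0 <= C by apply: le_trans (b2 a _); rewrite ?lexx.
  apply: (@le_trans _ _ (C * (x - a))); last by rewrite ler_wpM2l//; lra.
  by apply: mvt_normr_le => // y /andP[ay yx]; [apply: d2|apply: b2]; lra.
pose g x := f x - f1 a * x.
have -> : f b - f a - (b - a) * f1 a = g b - g a by rewrite /g; ring.
have dg x : a <= x <= b -> is_derive x 1 g (f1 x - f1 a).
  move=> xab; have ? := d1 x xab.
  by rewrite /g; apply: is_derive_eq; rewrite /GRing.scale /=; lra.
by rewrite expr2 mulrA; apply: (mvt_normr_le ab dg).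
Qed.

(** * The Gaussian tail and the heat kernel *)

Section gaussian.
Context (R : realType).
Implicit Types x z : R.

Definition gauss x : R := normal_peak 1 * expR (- x ^+ 2 / 2).

Definition gauss_tail x : R := 1 - Phi x.

Lemma normal_pdf1E h x : normal_pdf h 1 x = gauss (x - h).
Proof.
by rewrite normal_pdfE ?oner_eq0// /normal_fun /gauss expr1n.
Qed.

Lemma gauss_gt0 x : 0 < gauss x.
Proof. by rewrite mulr_gt0 ?expR_gt0// normal_peak_gt0 ?oner_eq0. Qed.

Lemma normal_peak1_le1 : normal_peak 1 <= 1 :> R.
Proof.
have p1 : 1 <= (pi : R) *+ 2 by have := @pi_ge2 R; lra.
have s1 : 1 <= Num.sqrt ((pi : R) *+ 2) by rewrite -[leLHS]sqrtr1 ler_wsqrtr.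
by rewrite /normal_peak expr1n mul1r invf_le1// (lt_le_trans _ s1).
Qed.

Lemma gauss_le_expR x : gauss x <= expR (- x ^+ 2 / 2).
Proof. by rewrite ler_piMl ?expR_ge0 ?normal_peak1_le1. Qed.

Lemma is_derive_Phi x : is_derive x 1 (@Phi R) (gauss x).
Proof.
have [||||] := @continuous_FTC1 R (normal_pdf 0 1) -oo%O x (x + 1).
- by rewrite ltrDl.
- by apply: integrableS (@integrable_normal_pdf R 0 1).
- exact: ltNyr.
- exact/continuous_normal_pdf/oner_neq0.
move=> dF eF; split; first exact: dF.
by rewrite -derive1E eF normal_pdf1E subr0.
Qed.

Global Instance is_derive_gauss_tail x : is_derive x 1 gauss_tail (- gauss x).
Proof.
rewrite /gauss_tail; have ? := is_derive_Phi x.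
by apply: is_derive_eq; rewrite add0r mul1r.
Qed.

Lemma gauss_tailE x : gauss_tail x = fine (normal_prob 0 1 `]x, +oo[).
Proof.
rewrite /gauss_tail /Phi -setCitvl.
rewrite (@probability_setC _ _ R (normal_prob 0 1))//.
by rewrite (@fineB _ 1%E (normal_prob 0 1 `]-oo, x]))// fin_num_measure.
Qed.

Lemma gauss_tail_ge0 x : 0 <= gauss_tail x.
Proof. by rewrite gauss_tailE fine_ge0. Qed.

Lemma Phi_ge0 x : 0 <= Phi x.
Proof. by rewrite /Phi fine_ge0. Qed.

Lemma gauss_tail_le1 x : gauss_tail x <= 1.
Proof. by rewrite /gauss_tail gerBl Phi_ge0. Qed.

(** The density of N(0,1) is that of N(h,1) times [expR (h ^+ 2 / 2 - h * x)], and on [A] this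
    factor is at most [expR (h ^+ 2 / 2 - c)]. *)
Lemma normal_prob_chernoff h c (A : set R) : measurable A ->
  (forall x, A x -> c <= h * x) ->
  fine (normal_prob 0 1 A) <= expR (h ^+ 2 / 2 - c).
Proof.
move=> mA Ac; rewrite -lee_fin fineK ?fin_num_measure//.
rewrite /normal_prob -[leRHS]mule1 -(@integral_normal_pdf R h 1).
have mp (s : R) (D : set R) : measurable D -> measurable_fun D (fun x => (normal_pdf s 1 x)%:E).
  by move=> mD; apply/measurable_EFinP/measurable_funTS; exact: measurable_normal_pdf.
rewrite -ge0_integralZl//; last 2 first.
  - by apply: mp.
  - by move=> x _; rewrite lee_fin normal_pdf_ge0.
apply: le_trans (_ : _ <= \int[lebesgue_measure]_(x in A)
    ((expR (h ^+ 2 / 2 - c))%:E * (normal_pdf h 1 x)%:E))%E _.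
  apply: ge0_le_integral => //.
  - by move=> x _; rewrite lee_fin normal_pdf_ge0.
  - exact: mp.
  - by apply: measurable_funeM; exact: mp.
  move=> x Ax; rewrite -EFinM lee_fin !normal_pdf1E subr0 /gauss mulrCA.
  rewrite ler_wpM2l ?normal_peak_ge0// -expRD ler_expR.
  by have := Ac x Ax; nra.
apply: ge0_subset_integral => //; first by apply: measurable_funeM; exact: mp.
by move=> x _; rewrite -EFinM lee_fin mulr_ge0 ?expR_ge0 ?normal_pdf_ge0.
Qed.

Lemma gauss_tail_chernoff x : 0 <= x -> gauss_tail x <= expR (- x ^+ 2 / 2).
Proof.
move=> x0; rewrite gauss_tailE.
rewrite (_ : - _ / 2 = x ^+ 2 / 2 - x ^+ 2); last by lra.
apply: normal_prob_chernoff => // y /=; rewrite in_itv/= andbT => /ltW xy.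
by rewrite expr2 ler_wpM2l.
Qed.

Lemma Phi_chernoff x : 0 <= x -> Phi (- x) <= expR (- x ^+ 2 / 2).
Proof.
move=> x0; rewrite (_ : - _ / 2 = (- x) ^+ 2 / 2 - x ^+ 2); last by rewrite sqrrN; lra.
apply: normal_prob_chernoff => // y /=; rewrite in_itv/= => yx.
by nra.
Qed.

Lemma gauss_tail_nonincreasing x z : x <= z -> gauss_tail z <= gauss_tail x.
Proof.
move=> xz; rewrite /gauss_tail lerD2l lerN2 /Phi fine_le ?fin_num_measure//.
by rewrite le_measure ?inE//; exact: subitvPr.
Qed.

(** The mass of the interval from [x] to [x + m^-1] suffices: there
    [y ^+ 2 - x ^+ 2 = (y - x) * (y + x)] is at most [m^-1 * (2 * m + 1) <= 3], so the density drops
    by at most [expR (- (3 / 2))]. This bound is what converts absolute errors into relative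
    ones. *)
Lemma gauss_tail_lower m x : 1 <= m -> `|x| <= m ->
  normal_peak 1 * expR (- (3 / 2)) * (expR (- x ^+ 2 / 2) / m) <= gauss_tail x.
Proof.
move=> m1; rewrite ler_norml => /andP[xm1 xm].
have m0 : 0 < m by lra.
have mV : m^-1 * m = 1 by rewrite mulVf// gt_eqF.
have im1 : m^-1 <= 1 by rewrite invf_le1.
have im0 : 0 < m^-1 by rewrite invr_gt0.
have [||y yx E] := @MVT_segment R gauss_tail (fun x => - gauss x) x (x + m^-1).
- by lra.
- by apply: derivable_within_continuous => y _; have [] := is_derive_gauss_tail y.
apply: le_trans (_ : _ <= gauss_tail x - gauss_tail (x + m^-1)) _; last first.
  by rewrite gerBl gauss_tail_ge0.
have -> : gauss_tail x - gauss_tail (x + m^-1) = gauss y * m^-1 by lra.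
move: yx; rewrite in_itv/= => /andP[xy yx].
rewrite /gauss -!mulrA ler_wpM2l ?normal_peak_ge0// mulrA ler_wpM2r ?(ltW im0)//.
rewrite -expRD ler_expR.
have : (y - x) * (y + x) <= 3; last by nra.
apply: le_trans (_ : _ <= m^-1 * (2 * m + 1)) _; last by nra.
have [?|?] := leP 0 (y + x); first by nra.
by nra.
Qed.

End gaussian.

Lemma scaleRE (R : realType) (a b : R) : a *: (b : R^o) = a * b. Proof. by []. Qed.

Section heat.
Context {R : realType}.
Implicit Types t w z : R.

(** For [t > 0] this is [t] to the power -1/2. In exponential form it is positive without hypothesis
    and is differentiated by the chain rule. *)
Definition isqrt t : R := expR (- ln t / 2).

Lemma isqrt_gt0 t : 0 < isqrt t. Proof. exact: expR_gt0. Qed.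

Lemma sqr_isqrt t : 0 < t -> isqrt t ^+ 2 = t^-1.
Proof.
by move=> t0; rewrite -expRM_natl -mulr_natl mulrCA mulfV// mulr1 expRN lnK.
Qed.

Lemma is_derive_isqrt t : 0 < t -> is_derive t 1 isqrt (- isqrt t ^+ 3 / 2).
Proof.
move=> t0; have ? := is_derive1_ln t0.
apply: is_derive_eq.
rewrite !scaleRE -/(isqrt t); have -> : isqrt t ^+ 3 = isqrt t * t^-1 by rewrite exprS sqr_isqrt.
by field; rewrite gt_eqF.
Qed.

(* [heat t (y - s)] is the probability that [s] plus a centred Gaussian of
   variance [t] exceeds [y]; [heat1], [heat2], [heat3] are its derivatives in
   [w = y - s], and [heat2t] is the time derivative of [heat2]. *)
Definition heat t w := gauss_tail (w * isqrt t).
Definition heat1 t w := - gauss (w * isqrt t) * isqrt t.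
Definition heat2 t w := (w * isqrt t) * gauss (w * isqrt t) * isqrt t ^+ 2.
Definition heat3 t w :=
  (1 - (w * isqrt t) ^+ 2) * gauss (w * isqrt t) * isqrt t ^+ 3.
Definition heat2t t w :=
  (w * isqrt t) * ((w * isqrt t) ^+ 2 - 3) / 2 * gauss (w * isqrt t) * isqrt t ^+ 4.

Lemma is_derive_heat t w : is_derive w 1 (heat t) (heat1 t w).
Proof.
by rewrite /heat; apply: is_derive_eq; rewrite /heat1 /gauss !scaleRE; field.
Qed.

Lemma is_derive_heat1 t w : is_derive w 1 (heat1 t) (heat2 t w).
Proof.
by rewrite /heat1; apply: is_derive_eq; rewrite /heat2 /gauss !scaleRE; field.
Qed.

Lemma is_derive_heat2 t w : is_derive w 1 (heat2 t) (heat3 t w).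
Proof.
by rewrite /heat2; apply: is_derive_eq; rewrite /heat3 /gauss !scaleRE; field.
Qed.

(** The heat equation: the time derivative is half of [heat2], the second derivative in space. It
    makes the variance of a summand cancel against an advance in time. *)
Lemma is_derive_heat_time t w : 0 < t ->
  is_derive t 1 (heat ^~ w) (heat2 t w / 2).
Proof.
move=> t0; have ? := is_derive_isqrt t0.
by rewrite /heat; apply: is_derive_eq; rewrite /heat2 /gauss !scaleRE; field.
Qed.

Lemma is_derive_heat2_time t w : 0 < t ->
  is_derive t 1 (heat2 ^~ w) (heat2t t w).
Proof.
move=> t0; have ? := is_derive_isqrt t0.
by rewrite /heat2; apply: is_derive_eq; rewrite /heat2t /gauss !scaleRE; field.
Qed.

(* [fun s => tilt h t (y - s)] is the expectation of [exp (h (s + G - y))] for a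
   Gaussian [G] of variance [t]; at [h = y] it has the order of the tail itself,
   so bounds proportional to it are relative bounds. *)
Definition tilt h t w := expR (- h * w + h ^+ 2 * t / 2).

(** Completing the square: [- w ^+ 2 / (2 * t)] equals [- h * w + h ^+ 2 * t / 2 - (w - h * t) ^+ 2
    / (2 * t)]. *)
Lemma expR_tilt h t w : 0 < t ->
  expR (- (w * isqrt t) ^+ 2 / 2) =
  tilt h t w * expR (- ((w - h * t) * isqrt t) ^+ 2 / 2).
Proof.
move=> t0; rewrite -expRD; congr expR.
rewrite !exprMn sqr_isqrt//; field; lra.
Qed.

(** Here [1 + z <= expR z], and [3 * z - z ^+ 2 / 2] is at most 9/2. *)
Lemma cube_expR_le z : 0 <= z -> (1 + z) ^+ 3 * expR (- z ^+ 2 / 2) <= expR 5.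
Proof.
move=> z0; apply: le_trans (_ : _ <= expR z ^+ 3 * expR (- z ^+ 2 / 2)) _.
  by rewrite ler_wpM2r ?expR_ge0// lerXn2r ?nnegrE ?expR_ge0 ?expR_ge1Dx//; lra.
rewrite -expRM_natl -expRD ler_expR; have := sqr_ge0 (z - 3); nra.
Qed.

(** After the tilt is extracted, a Gaussian factor in the recentred variable [y] is left. The
    recentring moves the argument by [h] times the square root of [t], at most [2 * m], so the
    polynomial is at most [(3 * m * (1 + |y|)) ^+ 3]: the Gaussian absorbs the part in [y], and
    [27 * m ^+ 3] remains. *)
Lemma cube_gauss_le m h t w : 0 < t <= 2 -> 1 <= m -> `|h| <= m ->
  (1 + `|w * isqrt t|) ^+ 3 * gauss (w * isqrt t) <=
  27 * expR 5 * m ^+ 3 * tilt h t w.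
Proof.
move=> /andP[t0 t2] m1 hm.
set y := (w - h * t) * isqrt t.
have E : w * isqrt t = y + h * (t * isqrt t) by rewrite /y; ring.
have ti : 0 <= t * isqrt t <= 2.
  have /ltW ti0 : 0 < t * isqrt t by rewrite mulr_gt0 ?isqrt_gt0.
  have : (t * isqrt t) ^+ 2 = t.
    by rewrite exprMn sqr_isqrt// expr2 mulfK// gt_eqF.
  by rewrite ti0/=; nra.
have m0 : 0 <= m by lra.
have le1 : 1 + `|w * isqrt t| <= 3 * m * (1 + `|y|).
  have : `|w * isqrt t| <= `|y| + m * 2.
    rewrite E (le_trans (ler_normD _ _))// lerD2l normrM.
    by rewrite (ger0_norm (_ : 0 <= t * _)) ?ler_pM//; lra.
  by have := normr_ge0 y; nra.
apply: le_trans (_ : _ <= (3 * m * (1 + `|y|)) ^+ 3 *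
    (tilt h t w * expR (- `|y| ^+ 2 / 2))) _.
  apply: ler_pM; rewrite ?(ltW (gauss_gt0 _))//.
  - by rewrite lerXn2r ?nnegrE ?addr_ge0 ?mulr_ge0 ?addr_ge0.
  - by rewrite real_normK ?num_real// -expR_tilt//; exact: gauss_le_expR.
rewrite exprMn (_ : (3 * m) ^+ 3 = 27 * m ^+ 3); last by ring.
rewrite [leLHS](_ : _ = 27 * m ^+ 3 * tilt h t w *
  ((1 + `|y|) ^+ 3 * expR (- `|y| ^+ 2 / 2))); last by ring.
rewrite [leRHS](_ : _ = 27 * m ^+ 3 * tilt h t w * expR 5); last by ring.
by rewrite ler_wpM2l ?cube_expR_le// !mulr_ge0 ?exprn_ge0 ?expR_ge0.
Qed.

End heat.

Section heat_bounds.
Context (R : realType).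
Variables (m h t0 : R).
Hypotheses (m1 : 1 <= m) (hm : `|h| <= m) (t01 : 0 < t0 <= 1).
Implicit Types t w z v r : R.

(** The power 4 is the largest number of factors [isqrt] in [heat1], [heat2], [heat3] and [heat2t];
    smaller powers are dominated since [isqrt t0 >= 1]. *)
Definition heat_const (m t0 : R) : R := 27 * expR 5 * m ^+ 3 * isqrt t0 ^+ 4.

Lemma heat_const_ge0 : 0 <= heat_const m t0.
Proof.
have m0 : 0 <= m by exact: le_trans ler01 m1.
by rewrite /heat_const !mulr_ge0 ?exprn_ge0 ?expR_ge0 ?(ltW (isqrt_gt0 _)).
Qed.

Lemma isqrt_ge1 : 1 <= isqrt t0.
Proof.
move: (m1) (t01) => m1' t01'.
case/andP: t01 => t00 t0le1.
by rewrite -[leLHS]expR0 ler_expR; have := ln_le0 t0le1; lra.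
Qed.

Lemma isqrt_exp_le t k : t0 <= t -> (k <= 4)%N -> isqrt t ^+ k <= isqrt t0 ^+ 4.
Proof.
move: (m1) (t01) => m1' t01'.
case/andP: t01 => t00 t0le1 t0t k4.
apply: le_trans (_ : _ <= isqrt t0 ^+ k) _.
  rewrite lerXn2r ?nnegrE ?(ltW (isqrt_gt0 _))// ler_expR.
  have : ln t0 <= ln t by rewrite ler_ln ?posrE//; lra.
  lra.
by rewrite ler_weXn2l// isqrt_ge1.
Qed.

Lemma tilt_ge0 t w : 0 <= tilt h t w. Proof. exact: expR_ge0. Qed.

(** All derivatives needed have this shape, with [a] a polynomial of degree at most 3, so one bound
    covers them. *)
Lemma weighted_gauss_le (a : R -> R) k t w : t0 <= t <= 2 -> (k <= 4)%N ->
  (forall z, `|a z| <= (1 + `|z|) ^+ 3) ->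
  `|a (w * isqrt t) * gauss (w * isqrt t) * isqrt t ^+ k| <=
    heat_const m t0 * tilt h t w.
Proof.
move: (m1) (t01) => m1' t01'.
case/andP: t01 => t00 t0le1 /andP[t0t t2] k4 ha.
rewrite normrM normrX normrM (ger0_norm (ltW (gauss_gt0 _))) (ger0_norm (ltW (isqrt_gt0 _))).
apply: le_trans (_ : _ <= 27 * expR 5 * m ^+ 3 * tilt h t w * isqrt t0 ^+ 4) _.
  apply: ler_pM; last exact: isqrt_exp_le.
  - exact: mulr_ge0 (normr_ge0 _) (ltW (gauss_gt0 _)).
  - exact/exprn_ge0/ltW/isqrt_gt0.
  have t00t2 : 0 < t <= 2 by lra.
  apply: le_trans (cube_gauss_le w t00t2 m1 hm).
  by rewrite ler_wpM2r ?(ltW (gauss_gt0 _)).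
by rewrite /heat_const; lra.
Qed.

Lemma heat1_le t w : t0 <= t <= 2 -> `|heat1 t w| <= heat_const m t0 * tilt h t w.
Proof.
move: (m1) (t01) => m1' t01'.
move=> tt; have := @weighted_gauss_le (fun=> -1) 1 t w tt isT.
rewrite /heat1 expr1 mulN1r; apply=> z.
by rewrite normrN1; have := normr_ge0 z; nra.
Qed.

Lemma heat2_le t w : t0 <= t <= 2 -> `|heat2 t w| <= heat_const m t0 * tilt h t w.
Proof.
move: (m1) (t01) => m1' t01'.
move=> tt; apply: (@weighted_gauss_le id 2 t w tt isT) => z /=.
by have := normr_ge0 z; nra.
Qed.

Lemma heat3_le t w : t0 <= t <= 2 -> `|heat3 t w| <= heat_const m t0 * tilt h t w.
Proof.
move: (m1) (t01) => m1' t01'.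
move=> tt; apply: (@weighted_gauss_le (fun z => 1 - z ^+ 2) 3 t w tt isT) => z /=.
apply: (le_trans (ler_normB _ _)); rewrite normr1 normrX.
by have := normr_ge0 z; nra.
Qed.

Lemma heat2t_le t w : t0 <= t <= 2 -> `|heat2t t w| <= heat_const m t0 * tilt h t w.
Proof.
move: (m1) (t01) => m1' t01'.
move=> tt.
apply: (@weighted_gauss_le (fun z => z * (z ^+ 2 - 3) / 2) 4 t w tt isT) => z /=.
rewrite !normrM (@ger0_norm _ (2^-1 : R))//.
have : `|z ^+ 2 - 3| <= `|z| ^+ 2 + 3.
  by apply: (le_trans (ler_normB _ _)); rewrite normrX lerD2l ger0_norm.
have a0 := normr_ge0 z; move=> /(ler_wpM2l a0).
have a2 : 0 <= `|z| ^+ 2 by rewrite exprn_ge0.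
have a3 : 0 <= `|z| ^+ 3 by rewrite exprn_ge0.
lra.
Qed.

Lemma tilt_shift_le t w r : tilt h t (w + r) <= expR (m * `|r|) * tilt h t w.
Proof.
move: (m1) (t01) => m1' t01'.
rewrite -expRD ler_expR.
have : - h * r <= m * `|r|.
  by rewrite (le_trans (ler_norm _))// normrM normrN ler_wpM2r.
by lra.
Qed.

Lemma tilt_time_le t s w : t <= s -> tilt h t w <= tilt h s w.
Proof. by move=> ts; rewrite ler_expR; have := sqr_ge0 h; nra. Qed.

Lemma heat_taylor_space t w r : t0 <= t <= 2 ->
  `|heat t (w - r) - heat t w + r * heat1 t w - r ^+ 2 / 2 * heat2 t w| <=
  heat_const m t0 * tilt h t w * (`|r| ^+ 3 * expR (m * `|r|)).
Proof.
move: (m1) (t01) => m1' t01'.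
move=> tt.
have := @taylor2_normr_le R (heat t) _ _ _ (heat_const m t0 * (expR (m * `|r|) * tilt h t w))
  w (- r) (is_derive_heat t) (is_derive_heat1 t) (is_derive_heat2 t).
rewrite sqrrN mulNr opprK normrN => /(_ _)/le_trans; apply; last first.
  by lra.
move=> x xw; apply: (le_trans (heat3_le _ tt)).
rewrite ler_wpM2l ?heat_const_ge0// -[in leLHS](subrKC w x).
apply: (le_trans (tilt_shift_le _ _ _)).
by rewrite ler_wpM2r ?tilt_ge0// ler_expR ler_wpM2l//; lra.
Qed.

Lemma heat_taylor_time t v w : t0 <= t -> 0 <= v -> t + v <= 2 ->
  `|heat (t + v) w - heat t w - v / 2 * heat2 t w| <=
  heat_const m t0 * tilt h (t + v) w * v ^+ 2.
Proof.
move: (m1) (t01) => m1' t01'.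
case/andP: t01 => t00 t0le1 t0t v0 tv.
have ttv : t <= t + v by lra.
have d1 (x : R) : t <= x <= t + v -> is_derive x 1 (heat ^~ w) (heat2 x w / 2).
  by move=> xt; apply: is_derive_heat_time; lra.
have d2 (x : R) : t <= x <= t + v ->
    is_derive x 1 (fun s => heat2 s w / 2) (heat2t x w / 2).
  move=> xt; have ? : is_derive x 1 (heat2 ^~ w) (heat2t x w).
    by apply: is_derive_heat2_time; lra.
  by apply: is_derive_eq; rewrite !scaleRE !mulr0 add0r mulrC.
have := taylor1_normr_le (C := heat_const m t0 * tilt h (t + v) w) ttv d1 d2.
rewrite (_ : t + v - t = v); last by lra.
rewrite (mulrAC v) mulrA; apply=> x xt.
rewrite normrM (@ger0_norm _ (2^-1 : R))//.
apply: (@le_trans _ _ `|heat2t x w|).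
  by rewrite ler_piMr//; lra.
apply: (le_trans (heat2t_le _ _)); first by lra.
by rewrite ler_wpM2l ?heat_const_ge0// tilt_time_le//; lra.
Qed.

(** Adding the value [r] and adding a Gaussian of variance [v] are both expanded at [(t, w)]. The
    difference of the main terms is linear in [r] and in [r ^+ 2 - v], quantities of small
    expectation. Both remainders are stated with the tilt at the later time, which is legitimate
    because the tilt increases with time. *)
Lemma heat_step t v w r : t0 <= t -> 0 <= v -> t + v <= 2 ->
  `|heat t (w - r) - heat (t + v) w + r * heat1 t w - (r ^+ 2 - v) / 2 * heat2 t w| <=
  heat_const m t0 * tilt h (t + v) w * (`|r| ^+ 3 * expR (m * `|r|) + v ^+ 2).
Proof.
move: (m1) (t01) => m1' t01'.
move=> t0t v0 tv.
have tt : t0 <= t <= 2 by lra.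
have H1 := heat_taylor_space w r tt.
have H2 := heat_taylor_time w t0t v0 tv.
have {H1} : `|heat t (w - r) - heat t w + r * heat1 t w - r ^+ 2 / 2 * heat2 t w| <=
  heat_const m t0 * tilt h (t + v) w * (`|r| ^+ 3 * expR (m * `|r|)).
  apply: (le_trans H1); rewrite ler_wpM2r ?mulr_ge0 ?exprn_ge0 ?expR_ge0//.
  by rewrite ler_wpM2l ?heat_const_ge0// tilt_time_le//; lra.
move: H2; rewrite mulrDr => H2 H1; apply: le_trans (lerD H1 H2).
have tri (a b c d e f : R) : `|a - c + r * e - (r ^+ 2 - v) / 2 * f| <=
    `|a - b + r * e - r ^+ 2 / 2 * f| + `|c - b - v / 2 * f|.
  rewrite -(normrN (c - b - v / 2 * f)) (le_trans _ (ler_normD _ _))// le_eqVlt;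
    by apply/predU1P; left; congr (`|_|); field.
exact: tri.
Qed.

End heat_bounds.

(** * Expectations and independence *)

Section bounded_expectation.
Context {d : measure_display} {T : measurableType d} {R : realType}.
Variable P : probability T R.
Implicit Types f g : T -> R.

(** Truncated variables lie in this class; it is stable under the operations of the replacement
    argument and makes every integral there finite. *)
Definition bounded_mfun f :=
  measurable_fun [set: T] f /\ exists M : R, forall w, `|f w| <= M.

Definition Ex f : R := (\int[P]_w f w)%R.

Lemma bounded_mfun_integrable f : bounded_mfun f ->
  P.-integrable [set: T] (EFin \o f).
Proof.
move=> [mf [M fM]]; apply: measurable_bounded_integrable => //.
  by rewrite -ge0_fin_numE ?fin_num_measure.
by exists M; split; [exact: num_real|move=> x Mx w _; exact: le_trans (fM w) (ltW Mx)].
Qed.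

Lemma bounded_mfun_cst c : bounded_mfun (fun=> c).
Proof. by split => //; exists `|c|. Qed.

Lemma bounded_mfunD f g : bounded_mfun f -> bounded_mfun g ->
  bounded_mfun (fun w => f w + g w).
Proof.
move=> [mf [M fM]] [mg [N gN]]; split; first exact: measurable_funD.
by exists (M + N) => w; rewrite (le_trans (ler_normD _ _))// lerD.
Qed.

Lemma bounded_mfunM f g : bounded_mfun f -> bounded_mfun g ->
  bounded_mfun (fun w => f w * g w).
Proof.
move=> [mf [M fM]] [mg [N gN]]; split; first exact: measurable_funM.
by exists (M * N) => w; rewrite normrM ler_pM.
Qed.

Lemma bounded_mfunZ c f : bounded_mfun f -> bounded_mfun (fun w => c * f w).
Proof. exact/bounded_mfunM/bounded_mfun_cst. Qed.

Lemma bounded_mfunB f g : bounded_mfun f -> bounded_mfun g ->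
  bounded_mfun (fun w => f w - g w).
Proof.
move=> bf bg; under eq_fun do rewrite -mulN1r.
by apply: bounded_mfunD => //; exact: bounded_mfunZ.
Qed.

Lemma bounded_mfun_norm f : bounded_mfun f -> bounded_mfun (fun w => `|f w|).
Proof.
move=> [mf [M fM]]; split; first exact: measurableT_comp.
by exists M => w; rewrite normr_id.
Qed.

Lemma bounded_mfunX f n : bounded_mfun f -> bounded_mfun (fun w => f w ^+ n).
Proof.
move=> bf; elim: n => [|n IH]; first exact: bounded_mfun_cst.
by under eq_fun do rewrite exprS; exact: bounded_mfunM.
Qed.

Lemma bounded_mfun_expR f : bounded_mfun f -> bounded_mfun (fun w => expR (f w)).
Proof.
move=> [mf [M fM]]; split; first exact: measurableT_comp.
exists (expR M) => w; rewrite ger0_norm ?expR_ge0// ler_expR.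
exact: le_trans (ler_norm _) (fM w).
Qed.

Lemma Ex_cst c : Ex (fun=> c) = c.
Proof. by rewrite /Ex Rintegral_cst//= probability_setT mulr1. Qed.

Lemma ExD f g : bounded_mfun f -> bounded_mfun g ->
  Ex (fun w => f w + g w) = Ex f + Ex g.
Proof. by move=> bf bg; rewrite /Ex RintegralD//; exact: bounded_mfun_integrable. Qed.

Lemma ExZ c f : bounded_mfun f -> Ex (fun w => c * f w) = c * Ex f.
Proof. by move=> bf; rewrite /Ex RintegralZl//; exact: bounded_mfun_integrable. Qed.

Lemma ExB f g : bounded_mfun f -> bounded_mfun g ->
  Ex (fun w => f w - g w) = Ex f - Ex g.
Proof. by move=> bf bg; rewrite /Ex RintegralB//; exact: bounded_mfun_integrable. Qed.

Lemma Ex_le f g : bounded_mfun f -> bounded_mfun g ->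
  (forall w, f w <= g w) -> Ex f <= Ex g.
Proof.
by move=> bf bg fg; apply: le_Rintegral => //; exact: bounded_mfun_integrable.
Qed.

Lemma Ex_ge0 f : (forall w, 0 <= f w) -> 0 <= Ex f.
Proof. by move=> f0; exact: Rintegral_ge0. Qed.

Lemma normr_Ex_le f g : bounded_mfun f -> bounded_mfun g ->
  (forall w, `|f w| <= g w) -> `|Ex f| <= Ex g.
Proof.
move=> bf bg fg.
apply: le_trans (le_normr_Rintegral measurableT (bounded_mfun_integrable bf)) _.
exact: Ex_le (bounded_mfun_norm bf) bg fg.
Qed.

Lemma EFin_Ex f : bounded_mfun f -> (Ex f)%:E = (\int[P]_w (f w)%:E)%E.
Proof.
move=> bf; rewrite /Ex /Rintegral fineK//.
exact: integrable_fin_num (bounded_mfun_integrable bf).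
Qed.

Lemma bounded_mfun_indic (A : set T) : measurable A -> bounded_mfun (\1_A : T -> R).
Proof.
move=> mA; split; first exact: measurable_indic.
by exists 1 => w; rewrite ger0_norm// indicE; case: (_ \in _).
Qed.

Lemma Ex_indic (A : set T) : measurable A -> (Ex (\1_A))%:E = P A.
Proof.
by move=> mA; rewrite EFin_Ex ?integral_indic ?setIT//; exact: bounded_mfun_indic.
Qed.

End bounded_expectation.

Section independent_pair.
Context {d : measure_display} {T : measurableType d} {R : realType}.
Variable P : probability T R.
Variables X Y : {RV P >-> R}.

Local Notation law := (distribution P X \x distribution P Y)%E.

Let XY w := (X w, Y w).

Lemma measurable_fun_XY : measurable_fun [set: T] XY.
Proof. exact: measurable_fun_pair. Qed.

(* The spectator event [Q] is what lets the independence of partial sums be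
   proved by induction on the number of summands. *)
Lemma law_pair (Q : set T) : measurable Q ->
  (forall A B, measurable A -> measurable B ->
    P (X @^-1` A `&` (Y @^-1` B `&` Q)) =
    (P (X @^-1` A) * (P (Y @^-1` B) * P Q))%E) ->
  forall E, measurable E -> P (XY @^-1` E `&` Q) = (law E * P Q)%E.
Proof.
move=> mQ ind E mE.
have mXYE : measurable (XY @^-1` E).
  by rewrite -[X in measurable X]setTI; exact: measurable_fun_XY.
have [PQ0|PQ0] := eqVneq (P Q) 0%E.
  rewrite PQ0 mule0; apply/eqP; rewrite eq_le measure_ge0 andbT -PQ0.
  by apply: le_measure; rewrite ?inE//; exact: measurableI.
have q0 : 0 < fine (P Q).
  by rewrite fine_gt0// lt0e PQ0 measure_ge0/= -ge0_fin_numE// fin_num_measure.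
have qV0 : 0 <= (fine (P Q))^-1 by rewrite invr_ge0 ltW.
have [nu nuE] : exists nu : {measure set (R * R) -> \bar R},
    forall A, nu A = P (XY @^-1` A `&` Q).
  by unshelve eexists (pushforward (mrestr P mQ) XY); first exact: measurable_fun_XY.
(* [m'] is the law of [XY] conditioned on [Q]. It agrees with the product of the marginals on
   rectangles, hence everywhere by uniqueness of the product measure. *)
pose m' := mscale (NngNum qV0) nu.
have m'E A : m' A = ((fine (P Q))^-1%:E * P (XY @^-1` A `&` Q))%E.
  by rewrite -nuE.
have PQE : P Q = (fine (P Q))%:E by rewrite fineK// fin_num_measure.
have -> : (law E = m' E)%E.
  apply: product_measure_unique => // A B mA mB.
  change (m' (A `*` B) = P (X @^-1` A) * P (Y @^-1` B))%E; rewrite m'E.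
  rewrite (_ : _ `&` Q = X @^-1` A `&` (Y @^-1` B `&` Q)); last first.
    by apply/seteqP; split => w /=; rewrite /XY/=; tauto.
  rewrite ind// PQE muleCA; congr (_ * _)%E.
  by rewrite muleCA -EFinM mulVf ?mule1// gt_eqF.
rewrite m'E PQE muleAC -EFinM mulVf ?mul1e// gt_eqF//.
Qed.

Hypothesis indXY : forall A B, measurable A -> measurable B ->
  P (X @^-1` A `&` Y @^-1` B) = (P (X @^-1` A) * P (Y @^-1` B))%E.

(** Tonelli for the law of the pair. The bound [M] is required only on attained sums, so that [g]
    may be an exponential when [X] and [Y] are bounded. *)
Lemma expectation_pair (g : R -> R) (M : R) : measurable_fun [set: R] g ->
  (forall r, 0 <= g r) -> (forall w w', g (X w + Y w') <= M) ->
  bounded_mfun (fun w => Ex P (fun w' => g (X w + Y w'))) /\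
  Ex P (fun w => g (X w + Y w)) = Ex P (fun w => Ex P (fun w' => g (X w + Y w'))).
Proof.
move=> mg g0 gM.
pose f (z : R * R) : \bar R := (g (z.1 + z.2))%:E.
have mf : measurable_fun [set: R * R] f.
  apply/measurable_EFinP; apply: measurableT_comp => //.
  by apply: measurable_funD.
have f0 z : (0 <= f z)%E by rewrite lee_fin.
have bXY w : bounded_mfun (fun w' => g (X w + Y w')).
  split; last by exists M => w'; rewrite ger0_norm.
  by apply: measurableT_comp => //; exact: measurable_funD.
have bXYd : bounded_mfun (fun w => g (X w + Y w)).
  split; last by exists M => w'; rewrite ger0_norm.
  by apply: measurableT_comp => //; exact: measurable_funD.
have innerE x : (\int[distribution P Y]_y f (x, y) = \int[P]_w' (g (x + Y w'))%:E)%E.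
  rewrite ge0_integral_distribution//.
  by apply: measurableT_comp mf _; exact: measurable_fun_pair.
have mF := measurable_fun_fubini_tonelli_F (m2 := distribution P Y) f mf f0.
have bF : bounded_mfun (fun w => Ex P (fun w' => g (X w + Y w'))).
  split; last first.
    exists M => w; rewrite ger0_norm ?Ex_ge0//.
    by rewrite -(Ex_cst P M); apply: Ex_le => //; exact: bounded_mfun_cst.
  apply/measurable_EFinP.
  rewrite (_ : _ \o _ = fubini_F (distribution P Y) f \o X).
    exact: measurableT_comp.
  by apply/funext => w /=; rewrite EFin_Ex// /fubini_F innerE.
split => //; apply/EFin_inj; rewrite !EFin_Ex//.
under [RHS]eq_integral do rewrite EFin_Ex// -innerE.
transitivity (\int[law]_z f z)%E; last first.
  rewrite fubini_tonelli1// ge0_integral_distribution// => y.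
  exact: integral_ge0.
pose XY' : {mfun T >-> (R * R)%type} := mfun_Sub (mem_set measurable_fun_XY).
transitivity (\int[distribution P XY']_z f z)%E.
  by rewrite ge0_integral_distribution.
apply: eq_measure_integral => E mE _ /=.
have := @law_pair setT measurableT _ _ mE.
rewrite setIT probability_setT mule1; apply=> A B mA mB.
by rewrite setIT mule1 indXY.
Qed.

End independent_pair.

Section independent_sum.
Context {d : measure_display} {T : measurableType d} {R : realType}.
Context {P : probability T R} {I : choiceType}.
Implicit Types (Z : I -> {RV P >-> R}) (s : seq I).

Definition indep_seq Z := forall s (B : I -> set R), uniq s ->
  (forall i, measurable (B i)) ->
  P (\bigcap_(i in [set` s]) (Z i @^-1` B i)) =
  (\prod_(i <- s) P (Z i @^-1` B i))%E.

Lemma measurable_fun_rv_sum Z s :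
  measurable_fun [set: T] (fun w => \sum_(i <- s) Z i w).
Proof. exact: measurable_sum. Qed.

Definition rv_sum Z s : {RV P >-> R} :=
  mfun_Sub (mem_set (measurable_fun_rv_sum Z s)).

Lemma rv_sumE Z s w : rv_sum Z s w = \sum_(i <- s) Z i w.
Proof. by []. Qed.

(** In the induction on [s], the variable split off the sum first joins the spectator list [s']. The
    induction hypothesis then gives the threefold factorisation that [law_pair] needs for the
    shorter sum and the variable [Z i]. *)
Lemma indep_rv_sum Z s s' (A : set R) (B : I -> set R) : indep_seq Z ->
  uniq (s ++ s') -> measurable A -> (forall i, measurable (B i)) ->
  P (rv_sum Z s @^-1` A `&` \bigcap_(i in [set` s']) (Z i @^-1` B i)) =
  (P (rv_sum Z s @^-1` A) * P (\bigcap_(i in [set` s']) (Z i @^-1` B i)))%E.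
Proof.
move=> indZ; elim: s s' A B => [|i s IH] s' A B /=.
  move=> us' mA mB.
  have [A0|A0] := pselect (A 0).
    rewrite (_ : rv_sum Z [::] @^-1` A = setT) ?setTI ?probability_setT ?mul1e//.
    by apply/seteqP; split => w //= _; rewrite big_nil.
  rewrite (_ : rv_sum Z [::] @^-1` A = set0) ?set0I ?measure0 ?mul0e//.
  by apply/seteqP; split => w //=; rewrite big_nil.
rewrite mem_cat negb_or => /andP[/andP[is_ is'] us] mA mB.
set Q := \bigcap_(j in [set` s']) _.
have ucons : uniq (s ++ i :: s').
  by rewrite uniq_catC /= mem_cat negb_or is_ is' uniq_catC.
have us' : uniq s' by move: us; rewrite cat_uniq => /and3P[].
have mQ : measurable Q.
  by apply: fin_bigcap_measurable => // j _; exact: measurable_funPTI.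
pose E := [set z : R * R | A (z.2 + z.1)].
have mE : measurable E.
  rewrite -[E]setTI; have : measurable_fun [set: R * R] (fun z => z.2 + z.1).
    exact: measurable_funD.
  exact.
have pairE (A' B' : set R) : measurable A' -> measurable B' ->
    P (rv_sum Z s @^-1` A' `&` (Z i @^-1` B' `&` Q)) =
    (P (rv_sum Z s @^-1` A') * (P (Z i @^-1` B') * P Q))%E.
  (* Overriding [B] at [i], which is not in [s'], merges the event on [Z i] and [Q] into one
     spectator event over [i :: s']. *)
  move=> mA' mB'; pose B'' j := if j == i then B' else B j.
  have mB'' j : measurable (B'' j) by rewrite /B''; case: ifP.
  have eqs' j : j \in s' -> B'' j = B j.
    by rewrite /B''; case: eqP => // ->; rewrite (negbTE is').
  have -> : Z i @^-1` B' `&` Q = \bigcap_(j in [set` i :: s']) (Z j @^-1` B'' j).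
    apply/seteqP; split => w /=.
      move=> [wB' wQ] j /=; rewrite inE => /orP[/eqP ->|js'].
        by rewrite /B'' eqxx.
      by rewrite eqs'//; exact: wQ.
    move=> wQ; split => [|j js'].
      by have := wQ i; rewrite /= mem_head /B'' eqxx; exact.
    by rewrite -eqs'//; apply: wQ; rewrite /= in_cons js' orbT.
  rewrite IH//; congr (_ * _)%E.
  rewrite indZ//; last by move: ucons; rewrite cat_uniq => /and3P[].
  rewrite big_cons {1}/B'' eqxx /Q indZ//; congr (_ * _)%E.
  by apply: eq_big_seq => j js'; rewrite eqs'.
have sumE : rv_sum Z (i :: s) @^-1` A = (fun w => (rv_sum Z s w, Z i w)) @^-1` E.
  by apply/seteqP; split => w /=; rewrite big_cons.
rewrite sumE (law_pair mQ pairE mE).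
(* With the whole space as spectator, [law_pair] recognises the remaining factor as the probability
   of the event on the longer sum. *)
have := @law_pair _ _ _ P (rv_sum Z s) (Z i) setT measurableT _ E mE.
rewrite setIT probability_setT mule1 => -> // A' B' mA' mB'.
have := IH [:: i] A' (fun=> B').
rewrite !bigcap_seq !big_seq1 setIT mule1; apply => //.
by move: ucons; rewrite -cat1s catA cat_uniq => /and3P[].
Qed.

Lemma indep_rv_sum_cons Z s i (A B : set R) : indep_seq Z ->
  uniq (i :: s) -> measurable A -> measurable B ->
  P (rv_sum Z s @^-1` A `&` Z i @^-1` B) =
  (P (rv_sum Z s @^-1` A) * P (Z i @^-1` B))%E.
Proof.
move=> indZ us mA mB; have := @indep_rv_sum Z s [:: i] A (fun=> B) indZ.
rewrite !bigcap_seq !big_seq1; apply => //.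
by rewrite uniq_catC.
Qed.

End independent_sum.

(** * Lindeberg replacement *)

Lemma measurable_heat (R : realType) (t : R) : measurable_fun [set: R] (heat t).
Proof.
apply: continuous_measurable_fun => w; apply: differentiable_continuous.
by apply/derivable1_diffP; have [] := is_derive_heat t w.
Qed.

(** The remainder has the same form as in [heat_step], so a single weighted third moment controls
    both the replacement and the exponential moments. *)
Lemma expR_taylor2 (R : realType) (m h r : R) : `|h| <= m ->
  expR (h * r) <= 1 + h * r + h ^+ 2 / 2 * r ^+ 2 +
    m ^+ 3 * (`|r| ^+ 3 * expR (m * `|r|)).
Proof.
move=> hm; have m0 : 0 <= m by exact: le_trans hm.
have d k (x : R) : is_derive x 1 (fun x => h ^+ k * expR (h * x)) (h ^+ k.+1 * expR (h * x)).
  by apply: is_derive_eq; rewrite !scaleRE exprS; ring.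
have b (x : R) : `|x - 0| <= `|r| -> `|h ^+ 3 * expR (h * x)| <= m ^+ 3 * expR (m * `|r|).
  rewrite subr0 => xr; rewrite normrM normrX (ger0_norm (expR_ge0 _)).
  rewrite ler_pM ?exprn_ge0 ?expR_ge0// ?lerXn2r ?nnegrE// ler_expR.
  by rewrite (le_trans (ler_norm _))// normrM ler_pM.
have := taylor2_normr_le (d 0%N) (d 1%N) (d 2%N) b.
rewrite add0r mulr0 expR0 expr0 expr1 !mul1r !mulr1 => /(le_trans (ler_norm _)).
by rewrite (mulrC (`|r| ^+ 3)) mulrA; lra.
Qed.

Section one_variable.
Context {d : measure_display} {T : measurableType d} {R : realType}.
Variable P : probability T R.
Variable Y : T -> R.
Hypothesis bY : bounded_mfun Y.
Variables m h v e : R.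
Hypotheses (m1 : 1 <= m) (hm : `|h| <= m) (v0 : 0 <= v).
Hypotheses (meanY : `|Ex P Y| <= e) (varY : `|Ex P (fun w => Y w ^+ 2) - v| <= e).
Hypothesis cubeY : Ex P (fun w => `|Y w| ^+ 3 * expR (m * `|Y w|)) <= e.

Local Notation cube := (fun w => `|Y w| ^+ 3 * expR (m * `|Y w|)).

Let bcube : bounded_mfun cube.
Proof.
apply: bounded_mfunM; first exact/bounded_mfunX/bounded_mfun_norm.
exact/bounded_mfun_expR/bounded_mfunZ/bounded_mfun_norm.
Qed.

Let bY2 : bounded_mfun (fun w => Y w ^+ 2).
Proof. exact: bounded_mfunX. Qed.

(** The defects of mean, of variance and the third order term each cost at most [m ^+ 3 * e], whence
    the 3. The bound is put in exponential form by [1 + u <= expR u], so that it multiplies over the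
    summands. *)
Lemma mgf_le : Ex P (fun w => expR (h * Y w)) <= expR (h ^+ 2 * v / 2 + 3 * m ^+ 3 * e).
Proof.
have bq : bounded_mfun (fun w => 1 + h * Y w + h ^+ 2 / 2 * Y w ^+ 2).
  apply: bounded_mfunD; last exact: bounded_mfunZ.
  by apply: bounded_mfunD; [exact: bounded_mfun_cst|exact: bounded_mfunZ].
apply: (@le_trans _ _ (1 + (h ^+ 2 * v / 2 + 3 * m ^+ 3 * e))); last exact: expR_ge1Dx.
apply: (@le_trans _ _ (Ex P (fun w => (1 + h * Y w + h ^+ 2 / 2 * Y w ^+ 2) + m ^+ 3 * cube w))).
  apply: Ex_le => [||w].
  - exact/bounded_mfun_expR/bounded_mfunZ.
  - by apply: bounded_mfunD => //; exact: bounded_mfunZ.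
  - exact: expR_taylor2.
rewrite ExD//; last exact: bounded_mfunZ.
rewrite ExZ//.
rewrite ExD ?ExZ//; [|by apply: bounded_mfunD; [exact: bounded_mfun_cst|exact: bounded_mfunZ]|exact: bounded_mfunZ].
rewrite ExD ?ExZ ?Ex_cst//; [|exact: bounded_mfun_cst|exact: bounded_mfunZ].
move: meanY varY cubeY m1 hm; set EY := Ex P Y; set EY2 := Ex P _; set EC := Ex P _.
move=> meanY' varY' cubeY' m1' hm'.
have e0 : 0 <= e by exact: le_trans meanY'.
have hEY : h * EY <= m ^+ 3 * e.
  apply: le_trans (ler_norm _) _; rewrite normrM ler_pM//.
  by rewrite (le_trans hm')// ler_eXnr.
have h2m : h ^+ 2 <= m ^+ 3.
  rewrite -real_normK ?num_real// (@le_trans _ _ (m ^+ 2))//.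
    by rewrite lerXn2r ?nnegrE//; lra.
  by rewrite ler_weXn2l.
have h20 := sqr_ge0 h.
have hEY2 : h ^+ 2 * (EY2 - v) <= m ^+ 3 * e.
  apply: le_trans (ler_norm _) _; rewrite normrM ler_pM//.
  by rewrite ger0_norm.
have m30 : 0 <= m ^+ 3 by rewrite exprn_ge0//; lra.
have hEC : m ^+ 3 * EC <= m ^+ 3 * e by rewrite ler_wpM2l.
have m3e : 0 <= m ^+ 3 * e by rewrite mulr_ge0.
lra.
Qed.

(** One replacement with the heat kernel abstracted: [c0], [c1], [c2] stand for the kernel and its
    two space derivatives at the partial sum. The mean costs [C * e], the variance half of that, the
    remainder [2 * C * e]; 4 rounds up the total. *)
Lemma Ex_expansion_le (f : R -> R) (c0 c1 c2 C : R) : measurable_fun [set: R] f ->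
  (forall r, `|f r| <= 1) -> `|c1| <= C -> `|c2| <= C -> v ^+ 2 <= e ->
  (forall r, `|f r - c0 + r * c1 - (r ^+ 2 - v) / 2 * c2| <=
     C * (`|r| ^+ 3 * expR (m * `|r|) + v ^+ 2)) ->
  `|Ex P (fun w => f (Y w)) - c0| <= 4 * C * e.
Proof.
move=> mf f1 hc1 hc2 ve hf.
have C0 : 0 <= C by exact: le_trans hc1.
have bf : bounded_mfun (fun w => f (Y w)).
  by split; [case: bY => mY _; exact: measurableT_comp mf mY|exists 1].
have bc c : @bounded_mfun _ T R (fun=> c) by exact: bounded_mfun_cst.
pose D w := (f (Y w) - c0 + c1 * Y w) - c2 / 2 * (Y w ^+ 2 - v).
have b1 : bounded_mfun (fun w => f (Y w) - c0) by exact: bounded_mfunB.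
have b2 : bounded_mfun (fun w => c1 * Y w) by exact: bounded_mfunZ.
have b3 : bounded_mfun (fun w => f (Y w) - c0 + c1 * Y w) by exact: bounded_mfunD.
have b4 : bounded_mfun (fun w => Y w ^+ 2 - v) by exact: bounded_mfunB.
have b5 : bounded_mfun (fun w => c2 / 2 * (Y w ^+ 2 - v)) by exact: bounded_mfunZ.
have DE : Ex P D = (Ex P (fun w => f (Y w)) - c0 + c1 * Ex P Y) -
    c2 / 2 * (Ex P (fun w => Y w ^+ 2) - v).
  by rewrite /D ExB// ExD// !ExZ// !ExB// !Ex_cst.
have HD : `|Ex P D| <= C * (e + e).
  apply: (@le_trans _ _ (Ex P (fun w => C * (cube w + v ^+ 2)))).
    apply: normr_Ex_le; first exact: bounded_mfunB.
      by apply: bounded_mfunZ; exact: bounded_mfunD.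
    move=> w; apply: le_trans (hf (Y w)).
    by rewrite le_eqVlt /D; apply/predU1P; left; congr (`|_|); field.
  rewrite ExZ; last exact: bounded_mfunD.
  by rewrite ExD// Ex_cst ler_wpM2l// lerD.
move: DE HD meanY varY; set EF := Ex P (fun w => f (Y w)).
set EY := Ex P Y; set EY2 := Ex P (fun w => Y w ^+ 2); set ED := Ex P D.
move=> DE HD hm' hv'.
have -> : EF - c0 = ED + (- (c1 * EY) + c2 / 2 * (EY2 - v)) by rewrite DE; ring.
apply: (le_trans (ler_normD _ _)).
have : `|- (c1 * EY) + c2 / 2 * (EY2 - v)| <= C * e + C / 2 * e.
  apply: (le_trans (ler_normD _ _)); rewrite normrN !normrM.
  rewrite (@ger0_norm _ (2^-1 : R))// lerD// ler_pM// ?mulr_ge0//.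
  by rewrite ler_wpM2r.
have e0 : 0 <= e by exact: le_trans hm'.
have Ce : 0 <= C * e by rewrite mulr_ge0.
lra.
Qed.

End one_variable.

Section lindeberg.
Context {d : measure_display} {T : measurableType d} {R : realType}.
Context {P : probability T R} {I : choiceType}.
Variable Z : I -> {RV P >-> R}.
Variables (v e : I -> R) (m h t0 : R).
Hypotheses (indZ : indep_seq Z) (bZ : forall i, bounded_mfun (Z i)).
Hypotheses (m1 : 1 <= m) (hm : `|h| <= m) (t01 : 0 < t0 <= 1).
Hypotheses (v0 : forall i, 0 <= v i) (v2 : forall i, v i ^+ 2 <= e i).
Hypothesis meanZ : forall i, `|Ex P (Z i)| <= e i.
Hypothesis varZ : forall i, `|Ex P (fun w => Z i w ^+ 2) - v i| <= e i.
Hypothesis cubeZ : forall i,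
  Ex P (fun w => `|Z i w| ^+ 3 * expR (m * `|Z i w|)) <= e i.

Lemma bounded_rv_sum s : bounded_mfun (rv_sum Z s).
Proof.
elim: s => [|i s IH].
  rewrite (_ : (rv_sum Z [::] : T -> R) = fun=> 0); first exact: bounded_mfun_cst.
  by apply/funext => w; rewrite rv_sumE big_nil.
rewrite (_ : (rv_sum Z (i :: s) : T -> R) = fun w => Z i w + rv_sum Z s w).
  exact: bounded_mfunD.
by apply/funext => w; rewrite !rv_sumE big_cons.
Qed.

Lemma Ex_rv_sum_cons (g : R -> R) i s : uniq (i :: s) -> measurable_fun [set: R] g ->
  (forall r, 0 <= g r) -> (forall M, exists N, forall r, `|r| <= M -> g r <= N) ->
  bounded_mfun (fun w => Ex P (fun w' => g (rv_sum Z s w + Z i w'))) /\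
  Ex P (fun w => g (rv_sum Z (i :: s) w)) =
  Ex P (fun w => Ex P (fun w' => g (rv_sum Z s w + Z i w'))).
Proof.
move=> us mg g0 gN.
have [_ [M1 hM1]] := bounded_rv_sum s.
have [_ [M2 hM2]] := bZ i.
have [N hN] := gN (M1 + M2).
rewrite (_ : (fun w => g (rv_sum Z (i :: s) w)) =
             fun w => g (rv_sum Z s w + Z i w)); last first.
  by apply/funext => w; rewrite !rv_sumE big_cons addrC.
exact: (expectation_pair (fun A B mA mB => indep_rv_sum_cons indZ us mA mB) mg g0
  (fun w w' => hN _ (le_trans (ler_normD _ _) (lerD (hM1 w) (hM2 w'))))).
Qed.

Lemma rv_sum_mgf_le s : uniq s -> Ex P (fun w => expR (h * rv_sum Z s w)) <=
  expR (h ^+ 2 * (\sum_(i <- s) v i) / 2 + 3 * m ^+ 3 * \sum_(i <- s) e i).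
Proof.
elim: s => [_|i s IH us].
  rewrite !big_nil !mulr0 mul0r addr0 expR0 -[leRHS](Ex_cst P 1).
  by rewrite le_eqVlt; apply/predU1P; left; congr (Ex P _); apply/funext => w;
    rewrite rv_sumE big_nil mulr0 expR0.
have mexp : measurable_fun [set: R] (fun r => expR (h * r)).
  by apply: measurableT_comp => //; exact: measurable_funM.
have bexp M : exists N, forall r, `|r| <= M -> expR (h * r) <= N.
  exists (expR (`|h| * M)) => r rM; rewrite ler_expR.
  by rewrite (le_trans (ler_norm _))// normrM ler_wpM2l.
have [_ ->] := Ex_rv_sum_cons us mexp (fun=> expR_ge0 _) bexp.
have bexpZ : bounded_mfun (fun w => expR (h * Z i w)).
  exact/bounded_mfun_expR/bounded_mfunZ.
have bexpS : bounded_mfun (fun w => expR (h * rv_sum Z s w)).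
  exact/bounded_mfun_expR/bounded_mfunZ/bounded_rv_sum.
rewrite (_ : (fun w => Ex P _) = fun w =>
    Ex P (fun w' => expR (h * Z i w')) * expR (h * rv_sum Z s w)); last first.
  apply/funext => w; rewrite mulrC -ExZ//; congr (Ex P _).
  by apply/funext => w'; rewrite mulrDr expRD.
rewrite ExZ// !big_cons mulrDr mulrDl mulrDr addrACA expRD.
move: us => /= /andP[_ us].
apply: ler_pM (mgf_le (bZ i) m1 hm _ _ _) (IH us) => //.
- by apply: Ex_ge0 => w; exact: expR_ge0.
- by apply: Ex_ge0 => w; exact: expR_ge0.
Qed.

(* Replacing [Z i] by a Gaussian of variance [v i] amounts to moving [heat]
   forward in time by [v i]. *)
Lemma rv_sum_heat_le y s t : uniq s -> t0 <= t -> t + \sum_(i <- s) v i <= 2 ->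
  `|Ex P (fun w => heat t (y - rv_sum Z s w)) - heat (t + \sum_(i <- s) v i) y| <=
  4 * heat_const m t0 * (\sum_(i <- s) e i) *
  expR (- h * y + h ^+ 2 * (t + \sum_(i <- s) v i) / 2 + 3 * m ^+ 3 * \sum_(i <- s) e i).
Proof.
move=> + t0t; elim: s t t0t => [t t0t _ _|i s IH t t0t us].
  rewrite !big_nil !(mulr0, mul0r) addr0.
  have -> : (fun w => heat t (y - rv_sum Z [::] w)) = (fun=> heat t y).
    by apply/funext => w; rewrite rv_sumE big_nil subr0.
  by rewrite Ex_cst subrr normr0.
have us' : uniq s by move: us => /= /andP[].
rewrite !big_cons; set V := \sum_(j <- s) v j; set E := \sum_(j <- s) e j.
have V0 : 0 <= V by exact: sumr_ge0.
have e0 j : 0 <= e j by exact: le_trans (sqr_ge0 _) (v2 j).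
have E0 : 0 <= E by exact: sumr_ge0.
move=> tvV; have m1' := m1; have t01' := t01; have vi0 := v0 i.
set C := 4 * heat_const m t0.
have C0 : 0 <= C by rewrite mulr_ge0 ?heat_const_ge0.
have hb z : measurable_fun [set: R] (fun r => heat t (z - r)).
  by apply: measurableT_comp (measurable_heat t) _; exact: measurable_funB.
have heat0 u z : 0 <= heat u z :> R by exact: gauss_tail_ge0.
have heatle1 u z : heat u z <= 1 :> R by exact: gauss_tail_le1.
have bh u : bounded_mfun (fun w => heat u (y - rv_sum Z s w)).
  split; last by exists 1 => w; rewrite ger0_norm.
  apply: measurableT_comp (measurable_heat u) _.
  by apply: measurable_funB => //; exact: measurable_funPT.
have bheat (M : R) : exists N, forall r, `|r| <= M -> heat t (y - r) <= N.
  by exists 1 => r _.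
have [bE ->] := Ex_rv_sum_cons us (hb y) (fun=> heat0 _ _) bheat.
set tv := t + v i; have t0tv : t0 <= tv by rewrite /tv; lra.
have -> : t + (v i + V) = tv + V by rewrite /tv; ring.
have bexpS : bounded_mfun (fun w => expR (h * rv_sum Z s w)).
  exact/bounded_mfun_expR/bounded_mfunZ/bounded_rv_sum.
(* Only [Z i] is replaced, with the sum over [s] frozen. The error carries
   [tilt h tv (y - rv_sum Z s w)], whose expectation is bounded by [rv_sum_mgf_le]. The time [tv]
   and the variance [V] still to come add up to the same final time at every step, so the errors of
   all steps share one exponential factor. *)
have step1 : `|Ex P (fun w => Ex P (fun w' => heat t (y - (rv_sum Z s w + Z i w')))) -
    Ex P (fun w => heat tv (y - rv_sum Z s w))| <=
    C * e i * expR (- h * y + h ^+ 2 * (tv + V) / 2 + 3 * m ^+ 3 * E).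
  rewrite -ExB//.
  apply: (@le_trans _ _ (Ex P (fun w => C * e i * expR (- h * y + h ^+ 2 * tv / 2) *
      expR (h * rv_sum Z s w)))).
    apply: normr_Ex_le; [exact: bounded_mfunB|exact: bounded_mfunZ|move=> w].
    under eq_fun do rewrite opprD addrA.
    have tt : t0 <= t <= 2 by rewrite t0t; lra.
    have tle : t <= tv by rewrite /tv; lra.
    have tv2 : t + v i <= 2 by lra.
    apply: le_trans (@Ex_expansion_le _ _ _ P (Z i) (bZ i) m (v i) (e i)
        (meanZ i) (varZ i) (cubeZ i) (fun r => heat t (y - rv_sum Z s w - r))
        _ _ _ (heat_const m t0 * tilt h tv (y - rv_sum Z s w))
        (hb _) _ _ _ (v2 i) (fun r => heat_step m1 hm t01 _ r t0t vi0 tv2)) _.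
    - by move=> r; rewrite ger0_norm.
    - apply: le_trans (heat1_le m1 hm t01 _ tt) _.
      by rewrite ler_wpM2l ?heat_const_ge0// tilt_time_le.
    - apply: le_trans (heat2_le m1 hm t01 _ tt) _.
      by rewrite ler_wpM2l ?heat_const_ge0// tilt_time_le.
    rewrite -[leRHS]mulrA -expRD /C /tilt.
    rewrite (_ : - h * y + _ + _ = - h * (y - rv_sum Z s w) + h ^+ 2 * tv / 2); last by ring.
    by rewrite le_eqVlt; apply/predU1P; left; ring.
  rewrite ExZ// -[leLHS]mulrA ler_wpM2l ?(mulr_ge0 C0 (e0 i))//.
  apply: (@le_trans _ _ (expR (- h * y + h ^+ 2 * tv / 2) *
     expR (h ^+ 2 * V / 2 + 3 * m ^+ 3 * E))).
    by rewrite ler_wpM2l ?expR_ge0// rv_sum_mgf_le.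
  by rewrite -expRD ler_expR; lra.
have tvV2 : tv + V <= 2 by rewrite /tv; lra.
have := IH tv t0tv us' tvV2; rewrite -/V -/E -/C => step2.
apply: (le_trans (ler_distD _ _ _)); apply: (le_trans (lerD step1 step2)).
rewrite -mulrDl -mulrDr ler_wpM2l ?(mulr_ge0 C0 (addr_ge0 (e0 i) E0))// ler_expR.
have : 0 <= m ^+ 3 * e i by rewrite mulr_ge0 ?exprn_ge0//; lra.
lra.
Qed.

End lindeberg.

(** * Truncation *)

Section real_integrable.
Context {d : measure_display} {T : measurableType d} {R : realType}.
Variable P : {measure set T -> \bar R}.
Implicit Types f g : T -> R.

Local Notation intP f := (P.-integrable [set: T] (EFin \o f)).

Lemma integrable_addr f g : intP f -> intP g -> intP (fun w => f w + g w).
Proof. by move=> fi gi; apply: (integrableD measurableT fi gi). Qed.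

Lemma integrable_subr f g : intP f -> intP g -> intP (fun w => f w - g w).
Proof. by move=> fi gi; apply: (integrableB measurableT fi gi). Qed.

Lemma integrable_scaler c f : intP f -> intP (fun w => c * f w).
Proof. by move=> fi; apply: (integrableZl measurableT c fi). Qed.

Lemma integrable_normr f : intP f -> intP (fun w => `|f w|).
Proof. by move=> fi; apply: (integrable_abse fi). Qed.

End real_integrable.

Section truncation.
Context {d : measure_display} {T : measurableType d} {R : realType}.
Variable P : probability T R.

Definition trunc (L r : R) : R := if `|r| <= L then r else 0.

Lemma truncE L r : trunc L r = r * \1_[set x | `|x| <= L] r.
Proof.
rewrite /trunc indicE; case: ifPn => rL; first by rewrite mem_set ?mulr1.
by rewrite memNset ?mulr0//; exact/negP.
Qed.

Lemma measurable_trunc L : measurable_fun [set: R] (trunc L).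
Proof.
rewrite (_ : trunc L = fun r => r * \1_[set x | `|x| <= L] r); last first.
  by apply/funext => r; exact: truncE.
apply: measurable_funM => //; apply: measurable_indic.
rewrite (_ : [set x | _] = `[- L, L]%classic)//.
by apply/seteqP; split => x /=; rewrite in_itv/= ler_norml.
Qed.

Lemma trunc_le L r : 0 <= L -> `|trunc L r| <= L.
Proof. by rewrite /trunc; case: ifPn => //; rewrite normr0. Qed.

Lemma normr_trunc_le L r : `|trunc L r| <= `|r|.
Proof. by rewrite /trunc; case: ifPn => //; rewrite normr0. Qed.

Definition trunc_rv L (Y : {RV P >-> R}) : {RV P >-> R} :=
  mfun_Sub (mem_set (measurableT_comp (measurable_trunc L) (measurable_funPT Y))).

Lemma trunc_rvE L Y w : trunc_rv L Y w = trunc L (Y w).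
Proof. by []. Qed.

Lemma bounded_trunc_rv L Y : 0 <= L -> bounded_mfun (trunc_rv L Y).
Proof.
by move=> L0; split; [exact: measurable_funPT|exists L => w; exact: trunc_le].
Qed.

Lemma indep_trunc_rv (I : choiceType) (Y : I -> {RV P >-> R}) L : indep_seq Y ->
  indep_seq (fun i => trunc_rv L (Y i)).
Proof.
move=> indY s B us mB; apply: (indY s (fun i => trunc L @^-1` B i)) => // i.
by rewrite -[X in measurable X]setTI; exact: measurable_trunc.
Qed.

Lemma sqr_le_powR (p x : R) : 2 < p -> 1 <= x -> x ^+ 2 <= x `^ p.
Proof. by move=> p2 x1; rewrite -powR_mulrn ?ler_powR//; lra. Qed.

Lemma powRN_ge1 (p th : R) : 0 <= p -> 0 < th <= 1 -> 1 <= th `^ (- p).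
Proof.
move=> p0 /andP[th0 th1]; rewrite powRN invf_ge1 ?powR_gt0//.
have : th `^ p <= 1 `^ p by apply: ge0_ler_powR; rewrite ?nnegrE ?(ltW th0).
by rewrite powR1.
Qed.

Lemma cutoff_le (p th x : R) : 2 < p -> 0 < th <= 1 -> th <= x ->
  1 <= th `^ (- p) * x `^ p.
Proof.
move=> p2 /andP[th0 th1] thx.
rewrite powRN -(@mulVf _ (th `^ p)) ?gt_eqF ?powR_gt0//.
by rewrite ler_wpM2l ?invr_ge0 ?powR_ge0// ge0_ler_powR ?nnegrE//; lra.
Qed.

Variable Y : {RV P >-> R}.
Variables (p m L th v l : R).
Hypotheses (p2 : 2 < p) (m1 : 1 <= m) (L1 : 1 <= L) (th01 : 0 < th <= 1).
Hypothesis mth : m * th <= 1.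
Hypothesis iY : P.-integrable [set: T] (EFin \o Y).
Hypothesis iY2 : P.-integrable [set: T] (EFin \o (fun w => Y w ^+ 2)).
Hypothesis iYp : P.-integrable [set: T] (EFin \o (fun w => `|Y w| `^ p)).
Hypotheses (meanY : Ex P Y = 0) (varY : Ex P (fun w => Y w ^+ 2) = v).
Hypotheses (absY : Ex P (fun w => `|Y w| `^ p) = l).

Let Z := trunc_rv L Y.

(* One bound for the errors in the mean, the variance and the weighted third
   moment of the truncated variable: values below [th] are charged to the
   variance [v], those above to the [p]-th moment [l]. *)
Definition trunc_err (p m L th v l : R) : R :=
  expR 1 * th * v + L ^+ 3 * expR (m * L) * th `^ (- p) * l.

Let k1 : 1 <= L ^+ 3 * expR (m * L) * th `^ (- p).
Proof.
have p2' := p2; have m1' := m1; have L1' := L1; case/andP: th01 => th0 th1.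
have e1 : 1 <= expR (m * L) by rewrite -[leLHS]expR0 ler_expR mulr_ge0//; lra.
have t1 : 1 <= th `^ (- p) by apply: powRN_ge1 => //; lra.
by rewrite !mulr_ege1// exprn_ege1.
Qed.

Let l0 : 0 <= l.
Proof. by rewrite -absY; apply: Ex_ge0 => w; exact: powR_ge0. Qed.

Let v0 : 0 <= v.
Proof. by rewrite -varY; apply: Ex_ge0 => w; exact: sqr_ge0. Qed.

Let l_le : l <= trunc_err p m L th v l.
Proof.
case/andP: th01 => th0 th1; rewrite /trunc_err -[leLHS]add0r lerD//.
  by rewrite !mulr_ge0 ?expR_ge0// ltW.
by rewrite ler_peMl.
Qed.

Let bZ : bounded_mfun Z.
Proof. by apply: bounded_trunc_rv; have := L1; lra. Qed.

(** Since [Y] is centred, only [Z - Y] contributes. It vanishes unless [|Y| > L >= 1], and there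
    [|Y|] is at most its [p]-th power; the variance is treated in the same way. *)
Lemma trunc_mean_le : `|Ex P Z| <= trunc_err p m L th v l.
Proof.
apply: le_trans l_le; rewrite -absY -[Ex P Z]subr0 -meanY.
have iZ := bounded_mfun_integrable P bZ.
rewrite -RintegralB//.
apply: le_trans (le_normr_Rintegral measurableT _) _.
  exact: integrable_subr.
apply: le_Rintegral => // [|w _].
  exact/integrable_normr/integrable_subr.
rewrite trunc_rvE /trunc; case: ifPn => [_|].
  by rewrite subrr normr0 powR_ge0.
rewrite -ltNge sub0r normrN => LY; have L1' := L1; have p2' := p2.
by rewrite -[leLHS]powRr1// ler_powR//; lra.
Qed.

Lemma trunc_var_le : `|Ex P (fun w => Z w ^+ 2) - v| <= trunc_err p m L th v l.
Proof.
apply: le_trans l_le; rewrite -absY -varY.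
have iZ := bounded_mfun_integrable P (bounded_mfunX 2 bZ).
rewrite -RintegralB//.
apply: le_trans (le_normr_Rintegral measurableT _) _.
  exact: integrable_subr.
apply: le_Rintegral => // [|w _].
  exact/integrable_normr/integrable_subr.
rewrite trunc_rvE /trunc; case: ifPn => [_|].
  by rewrite subrr normr0 powR_ge0.
rewrite -ltNge expr0n/= sub0r normrN normrX => LY; have L1' := L1.
by apply: sqr_le_powR => //; lra.
Qed.

Let Ex_combination_le (f : T -> R) (a b : R) : P.-integrable [set: T] (EFin \o f) ->
  (forall w, f w <= a * Y w ^+ 2 + b * `|Y w| `^ p) -> Ex P f <= a * v + b * l.
Proof.
move=> intf fY; rewrite -varY -absY -!RintegralZl// -RintegralD//.
- apply: le_Rintegral => //.
  by apply: integrable_addr; exact: integrable_scaler.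
- exact: integrable_scaler.
- exact: integrable_scaler.
Qed.

(** Below [th] the exponential weight is at most [expR 1] because [m * th <= 1], one factor of the
    cube is at most [th], and the other two give the variance. Above [th] the bounds by [L] apply,
    and [th]^ (- p) * |Y| [^ p >= 1] brings in the [p]-th moment. *)
Lemma trunc_cube_le :
  Ex P (fun w => `|Z w| ^+ 3 * expR (m * `|Z w|)) <= trunc_err p m L th v l.
Proof.
apply: Ex_combination_le => [|w].
  apply: bounded_mfun_integrable; apply: bounded_mfunM.
    exact/bounded_mfunX/bounded_mfun_norm.
  exact/bounded_mfun_expR/bounded_mfunZ/bounded_mfun_norm.
have := p2; have := mth; have := m1; have := L1; case/andP: (th01) => th0 th1.
move=> L1' m1' mth' p2'; rewrite trunc_rvE.
have zL : `|trunc L (Y w)| <= L by apply: trunc_le; lra.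
have zY := normr_trunc_le L (Y w).
set z := `|trunc L (Y w)| in zL zY *.
have z0 : 0 <= z by exact: normr_ge0.
have [Yth|Yth] := leP `|Y w| th.
  rewrite -[leLHS]addr0 lerD//; last first.
    by rewrite !mulr_ge0 ?exprn_ge0 ?expR_ge0 ?powR_ge0//; lra.
  have ez : expR (m * z) <= expR 1.
    by rewrite ler_expR (le_trans _ mth')// ler_wpM2l//; lra.
  rewrite -mulrA mulrC ler_pM ?exprn_ge0 ?expR_ge0//.
  rewrite exprS ler_pM// ?exprn_ge0//; first lra.
  by rewrite -[leRHS]real_normK ?num_real// lerXn2r ?nnegrE.
rewrite -[leLHS]add0r lerD//.
  exact: mulr_ge0 (mulr_ge0 (expR_ge0 _) (ltW th0)) (sqr_ge0 _).
rewrite -mulrA -[leLHS]mulr1 ler_pM ?mulr_ge0 ?exprn_ge0 ?expR_ge0//.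
  rewrite ler_pM ?exprn_ge0 ?expR_ge0//; first by rewrite lerXn2r ?nnegrE//; lra.
  by rewrite ler_expR ler_wpM2l//; lra.
by apply: cutoff_le => //; exact: ltW.
Qed.

(** The square [v ^+ 2] is the time remainder in [heat_step]. Pointwise [Y ^+ 2 <= th + th]^ (- p) *
    |Y| [^ p], by the cases [|Y| <= th], [th < |Y| < 1] and [|Y| >= 1]; this is integrated and
    multiplied by [v <= 1]. *)
Lemma trunc_var_sqr_le : v <= 1 -> v ^+ 2 <= trunc_err p m L th v l.
Proof.
move=> v1.
have := p2; have := mth; have := m1; have := L1; case/andP: (th01) => th0 th1.
move=> L1' m1' mth' p2'.
have vb : v <= th + th `^ (- p) * l.
  rewrite -[v]varY -absY -RintegralZl// -[X in _ <= X + _](Ex_cst P) -RintegralD//; last 2 first.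
  - exact/bounded_mfun_integrable/bounded_mfun_cst.
  - exact: integrable_scaler.
  apply: le_Rintegral => // [|w _].
    apply: integrable_addr; last exact: integrable_scaler.
    exact/bounded_mfun_integrable/bounded_mfun_cst.
  have c0 : 0 <= th `^ (- p) * `|Y w| `^ p by rewrite mulr_ge0 ?powR_ge0.
  rewrite -[leLHS]real_normK ?num_real//.
  have [Yth|Yth] := leP `|Y w| th.
    have := normr_ge0 (Y w); nra.
  have [Y1|Y1] := leP 1 `|Y w|.
    apply: le_trans (sqr_le_powR p2 Y1) _.
    rewrite ler_wpDl ?(ltW th0)// ler_peMl ?powR_ge0//.
    by apply: powRN_ge1 => //; lra.
  apply: (@le_trans _ _ 1); first by rewrite expr_le1// (ltW Y1).
  apply: le_trans (cutoff_le p2 th01 (ltW Yth)) _.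
  by rewrite lerDr (ltW th0).
have l0' := l0; have v0' := v0.
have hk : th `^ (- p) * l <= L ^+ 3 * expR (m * L) * th `^ (- p) * l.
  rewrite ler_wpM2r// ler_peMl ?powR_ge0// mulr_ege1// ?exprn_ege1//.
  by rewrite -[leLHS]expR0 ler_expR mulr_ge0//; lra.
have e1 : 1 <= expR 1 :> R by rewrite -[leLHS]expR0 ler_expR.
have ht : th * v <= expR 1 * th * v.
  by rewrite -mulrA ler_peMl// mulr_ge0// (ltW th0).
rewrite /trunc_err; apply: le_trans (lerD ht hk).
apply: (@le_trans _ _ (v * (th + th `^ (- p) * l))).
  by rewrite expr2 ler_wpM2l.
rewrite mulrDr mulrC lerD2l.
by rewrite ler_piMl// mulr_ge0// powR_ge0.
Qed.

Lemma trunc_neq_prob : (P [set w | Y w != Z w] <= (L `^ (- p) * l)%:E)%E.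
Proof.
have p2' := p2; have L1' := L1.
have mYZ : measurable [set w | Y w != Z w].
  rewrite (_ : [set w | _] = (fun w => `|Y w|) @^-1` `]L, +oo[).
    have mN : measurable_fun [set: T] (fun w => `|Y w|) by exact: measurableT_comp.
    by rewrite -[X in measurable X]setTI; exact: mN.
  apply/seteqP; split => w /=; rewrite in_itv/= andbT /trunc ltNge.
    by case: ifPn => //; rewrite eqxx.
  move=> LY; rewrite (negbTE LY); apply: contraNN LY => /eqP ->.
  by rewrite normr0; lra.
rewrite -Ex_indic// lee_fin -absY -RintegralZl//.
apply: le_Rintegral => // [||w _].
- exact/bounded_mfun_integrable/bounded_mfun_indic.
- exact: integrable_scaler.
rewrite indicE; have [|_] := boolP (w \in _); last by rewrite mulr_ge0 ?powR_ge0.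
rewrite inE/= /trunc; case: ifPn => [|+ _]; first by rewrite eqxx.
rewrite -ltNge => /ltW LY; rewrite powRN -(@mulVf _ (L `^ p)) ?gt_eqF ?powR_gt0//.
  by rewrite ler_wpM2l ?invr_ge0 ?powR_ge0// ge0_ler_powR ?nnegrE//; lra.
lra.
Qed.

End truncation.

(** * Moderate deviations of finite sums *)

(* The smoothing variance is [m ^- 8], so a shift by [m ^- 2] is [m ^+ 2] standard
   deviations. *)
Section heat_estimates.
Context {R : realType}.
Implicit Types m x y t V : R.

Lemma isqrt_exprV m : 0 < m -> isqrt (m ^- 8) = m ^+ 4.
Proof.
move=> m0; apply/eqP; rewrite -(@eqrXn2 _ 2)// ?exprn_ge0 ?(ltW (isqrt_gt0 _)) ?ltW//.
by rewrite sqr_isqrt ?invr_gt0 ?exprn_gt0// invrK -exprM.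
Qed.

Lemma heat_ge m y s : 0 < m -> y - s <= - m ^- 2 ->
  1 - expR (- m ^+ 4 / 2) <= heat (m ^- 8) (y - s).
Proof.
move=> m0 ys; rewrite /heat isqrt_exprV//.
have m20 : 0 <= m ^+ 2 by rewrite exprn_ge0// ltW.
apply: (@le_trans _ _ (gauss_tail (- m ^+ 2))); last first.
  apply: gauss_tail_nonincreasing.
  rewrite (_ : - m ^+ 2 = - m ^- 2 * m ^+ 4); last by field; lra.
  by rewrite ler_wpM2r// exprn_ge0// ltW.
rewrite /gauss_tail lerD2l lerN2.
have := Phi_chernoff m20.
by rewrite -exprM.
Qed.

Lemma heat_le m y s : 0 < m -> m ^- 2 <= y - s ->
  heat (m ^- 8) (y - s) <= expR (- m ^+ 4 / 2).
Proof.
move=> m0 ys; rewrite /heat isqrt_exprV//.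
have m20 : 0 <= m ^+ 2 by rewrite exprn_ge0// ltW.
apply: (@le_trans _ _ (gauss_tail (m ^+ 2))).
  apply: gauss_tail_nonincreasing.
  rewrite (_ : m ^+ 2 = m ^- 2 * m ^+ 4); last by field; lra.
  by rewrite ler_wpM2r// exprn_ge0// ltW.
have := gauss_tail_chernoff m20.
by rewrite -exprM.
Qed.

Lemma inv_exp_le m k l : 1 <= m -> (l <= k)%N -> m ^- k <= m ^- l.
Proof.
move=> m1 lk; rewrite lef_pV2 ?posrE ?exprn_gt0 ?ler_weXn2l//; lra.
Qed.

(** The argument of the tail moves from [x] by at most [3 * m ^- 2]. As [|x| <= m], this raises the
    exponent [- x ^+ 2 / 2] by at most [3 / m < 1], so the density along the way stays below
    [expR 1 * expR (- x ^+ 2 / 2)]. *)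
Lemma heat_gauss_tail m x y t : 4 <= m -> `|x| <= m -> `|y - x| <= 2 * m ^- 2 ->
  `|t - 1| <= m ^- 8 ->
  `|heat t y - gauss_tail x| <= 3 * expR 1 * (m ^- 2 * expR (- x ^+ 2 / 2)).
Proof.
move=> m4 xm yx t1.
have mV : m * m^-1 = 1 by rewrite mulfV// gt_eqF//; lra.
have q0 : 0 < m^-1 by rewrite invr_gt0; lra.
have q4 : m^-1 <= 4^-1 by rewrite lef_pV2 ?posrE//; lra.
set q := m^-1 in mV q0 q4.
have m2q : m ^- 2 = q ^+ 2 by rewrite exprVn.
have m8q : m ^- 8 = q ^+ 8 by rewrite exprVn.
rewrite m2q m8q in yx t1 *.
have q81 : q ^+ 8 <= 4^-1 * q ^+ 7.
  by rewrite exprS ler_wpM2r// exprn_ge0// ltW.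
have q7 : q ^+ 7 <= 1 by rewrite exprn_ile1//; lra.
have q70 : 0 <= q ^+ 7 by rewrite exprn_ge0// ltW.
move: t1; rewrite ler_norml => /andP[t1 t2].
have t0 : 3 / 4 <= t by lra.
set c := isqrt t.
have c0 : 0 < c by exact: isqrt_gt0.
have c2 : c ^+ 2 * t = 1 by rewrite sqr_isqrt ?mulVf ?gt_eqF//; lra.
have c1 : `|c - 1| <= 2 * q ^+ 8.
  have cc : `|c ^+ 2 - 1| <= 2 * q ^+ 8.
    rewrite ler_norml; nra.
  apply: le_trans cc; rewrite subr_sqr_1 normrM ler_peMr//.
  by rewrite ger0_norm; lra.
have ycx : `|y * c - x| <= 3 * q ^+ 2.
  rewrite (_ : y * c - x = (y - x) + y * (c - 1)); last by ring.
  apply: le_trans (ler_normD _ _) _.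
  have ym : `|y| <= m + 1.
    rewrite -(subrK x y); apply: le_trans (ler_normD _ _) _.
    have : q ^+ 2 <= 4^-1 by rewrite expr2; nra.
    lra.
  have : `|y * (c - 1)| <= (m + 1) * (2 * q ^+ 8) by rewrite normrM ler_pM.
  have : (m + 1) * (2 * q ^+ 8) <= q ^+ 2.
    have -> : (m + 1) * (2 * q ^+ 8) = 2 * (m * q + q) * q ^+ 5 * q ^+ 2 by ring.
    rewrite mV ler_piMl ?sqr_ge0//.
    have : q ^+ 5 <= 4^-1.
      by rewrite exprS; have : q ^+ 4 <= 1 by [rewrite exprn_ile1//; lra]; have : 0 <= q ^+ 4 by [rewrite exprn_ge0// ltW]; nra.
    have : 0 <= q ^+ 5 by rewrite exprn_ge0// ltW.
    nra.
  lra.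
rewrite /heat -(subrKC x (y * c)).
have := @mvt_normr_le_sym R (@gauss_tail R) (fun z => - gauss z)
  (expR 1 * expR (- x ^+ 2 / 2)) x (y * c - x) (@is_derive_gauss_tail R) _.
move=> /(_ _)/le_trans; apply; last first.
  rewrite [leRHS](_ : _ = expR 1 * expR (- x ^+ 2 / 2) * (3 * q ^+ 2)); last by ring.
  by rewrite ler_wpM2l// mulr_ge0 ?expR_ge0.
move=> z zx; rewrite normrN ger0_norm ?(ltW (gauss_gt0 _))//.
apply: le_trans (gauss_le_expR _) _; rewrite -expRD ler_expR.
have zx3 : `|z - x| <= 3 * q ^+ 2 by exact: le_trans ycx.
have : `|x * (z - x)| <= m * (3 * q ^+ 2) by rewrite normrM ler_pM.
rewrite (_ : m * (3 * q ^+ 2) = 3 * q * (m * q)); last by ring.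
rewrite mV mulr1 => xzx.
have := le_trans (ler_norm _) xzx; have := sqr_ge0 (z - x); rewrite -normrN in xzx.
have := le_trans (ler_norm _) xzx.
nra.
Qed.

End heat_estimates.

Lemma sandwich_le (R : realFieldType) (a b1 b2 c eta n k1 k2 k3 r : R) :
  a <= b1 + eta + n -> b2 <= a + eta + n ->
  `|b1 - c| <= k1 * r -> `|b2 - c| <= k1 * r -> eta <= k2 * r -> n <= k3 * r ->
  `|a - c| <= (k3 + k2 + k1) * r.
Proof. by rewrite !ler_norml; lra. Qed.

Section finite_sums.
Context {d : measure_display} {T : measurableType d} {R : realType}.
Context {P : probability T R} {I : choiceType}.

Lemma bounded_mfun_sum (f : I -> T -> R) (s : seq I) :
  (forall i, bounded_mfun (f i)) -> bounded_mfun (fun w => \sum_(i <- s) f i w).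
Proof.
move=> bf; elim: s => [|i s IH].
  by under eq_fun do rewrite big_nil; exact: bounded_mfun_cst.
by under eq_fun do rewrite big_cons; exact: bounded_mfunD.
Qed.

Lemma Ex_sum (f : I -> T -> R) (s : seq I) : (forall i, bounded_mfun (f i)) ->
  Ex P (fun w => \sum_(i <- s) f i w) = \sum_(i <- s) Ex P (f i).
Proof.
move=> bf; elim: s => [|i s IH].
  by under eq_fun do rewrite big_nil; rewrite big_nil Ex_cst.
under eq_fun do rewrite big_cons.
by rewrite big_cons ExD ?IH//; exact: bounded_mfun_sum.
Qed.

Variables (Y : I -> {RV P >-> R}) (W : T -> R) (v l : I -> R) (p m M x : R).
Variable s : seq I.
Hypotheses (indY : indep_seq Y) (mW : measurable_fun [set: T] W) (us : uniq s).
Hypotheses (p2 : 2 < p) (M0 : 0 <= M) (xm : `|x| <= m).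
Hypothesis iY : forall i, P.-integrable [set: T] (EFin \o Y i).
Hypothesis iY2 : forall i, P.-integrable [set: T] (EFin \o (fun w => Y i w ^+ 2)).
Hypothesis iYp : forall i, P.-integrable [set: T] (EFin \o (fun w => `|Y i w| `^ p)).
Hypotheses (meanY : forall i, Ex P (Y i) = 0)
  (varY : forall i, Ex P (fun w => Y i w ^+ 2) = v i)
  (absY : forall i, Ex P (fun w => `|Y i w| `^ p) = l i).
Hypotheses (v1 : forall i, v i <= 1)
  (sumv : 1 - m ^- 8 <= \sum_(i <- s) v i <= 1)
  (suml : \sum_(i <- s) l i <= M * expR (- m ^+ 2 / 2)).
Hypothesis closeW :
  (P [set w | (m ^- 2 < `|W w - \sum_(i <- s) Y i w|)%R]
   <= (m ^- 2 * expR (- m ^+ 2 / 2))%:E)%E.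
Hypotheses (m4 : 4 <= m) (mM : 3 * (expR 1 + M) <= m)
  (mlarge : m ^+ 24 * expR (- m ^+ 2 / (8 * p)) <= 1).

Let L := m / 4.
Let th := expR (- m ^+ 2 / (8 * p)).
Let Z i := trunc_rv L (Y i).
Let S := rv_sum Z s.
Let e i := trunc_err p m L th (v i) (l i).
Let eta := expR (- m ^+ 4 / 2).
Let gap := [set w | m ^- 2 < `|W w - \sum_(i <- s) Y i w|].
(* [N w] counts what can make [W] differ from the truncated sum by more than
   [m ^- 2]; it is integer valued. *)
Let N w : R := \sum_(i <- s) \1_[set w | Y i w != Z i w] w + \1_gap w.

Let measurable_neq i : measurable [set w | Y i w != Z i w].
Proof.
have := measurable_funB (measurable_funPT (Y i)) (measurable_funPT (Z i)).
move=> /(_ measurableT [set~ 0]); rewrite setTI => mYZ.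
rewrite (_ : [set w | _] = (Y i \- Z i) @^-1` [set~ 0]).
  by apply: mYZ; exact: measurableC.
by apply/seteqP; split => w /=; rewrite -subr_eq0 => /eqP.
Qed.

Let measurable_gap : measurable gap.
Proof.
have mD : measurable_fun [set: T] (fun w => `|W w - \sum_(i <- s) Y i w|).
  apply: measurableT_comp => //; apply: measurable_funB => //.
  exact: measurable_fun_rv_sum.
rewrite (_ : gap = (fun w => `|W w - \sum_(i <- s) Y i w|) @^-1` `]m ^- 2, +oo[).
  by rewrite -[X in measurable X]setTI; exact: mD.
by apply/seteqP; split => w /=; rewrite in_itv/= andbT.
Qed.

Let bounded_N : bounded_mfun N.
Proof.
apply: bounded_mfunD; last exact: bounded_mfun_indic.
by apply: bounded_mfun_sum => i; exact: bounded_mfun_indic.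
Qed.

Let N0 w : N w = 0 -> rv_sum Z s w = \sum_(i <- s) Y i w /\
  `|W w - \sum_(i <- s) Y i w| <= m ^- 2.
Proof.
have i0 (A : set T) : 0 <= \1_A w :> R by rewrite indicE.
move/eqP; rewrite paddr_eq0 ?sumr_ge0// => /andP[].
rewrite psumr_eq0// => /allP sN gN; split.
  rewrite rv_sumE; apply: eq_big_seq => i is_.
  have := sN i is_; rewrite /= indicE pnatr_eq0 eqb0 => /negP h.
  apply/esym/eqP/negP => /negP h'; apply: h; exact/mem_set.
move: gN; rewrite indicE pnatr_eq0 eqb0 => /negP h.
by rewrite leNgt; apply/negP => h'; apply: h; exact/mem_set.
Qed.

Let N1 w : N w = 0 \/ 1 <= N w.
Proof.
have [n ->] : exists n : nat, N w = n%:R.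
  rewrite /N -natr_sum -natrD; by eexists.
by case: n => [|n]; [left|right; rewrite ler1n].
Qed.

Let Ex_N : Ex P N <= (16 * M + 1) * (m ^- 2 * expR (- x ^+ 2 / 2)).
Proof.
have p2' := p2; have m4' := m4; have M0' := M0.
have L1 : 1 <= L by rewrite /L; lra.
have mx : expR (- m ^+ 2 / 2) <= expR (- x ^+ 2 / 2).
  rewrite ler_expR -(real_normK (num_real x)).
  by have := normr_ge0 x; move: xm; nra.
have q0 : 0 <= m ^- 2 by rewrite invr_ge0 exprn_ge0//; lra.
have lneq i : Ex P (\1_[set w | Y i w != Z i w]) <= 16 * m ^- 2 * l i.
  have h1 := trunc_neq_prob p2 L1 (iYp i) (absY i).
  rewrite -Ex_indic// lee_fin in h1; apply: (le_trans h1).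
  have li : 0 <= l i by rewrite -absY; apply: Ex_ge0 => w; exact: powR_ge0.
  rewrite ler_wpM2r//.
  apply: (@le_trans _ _ (L `^ (- 2))); first by rewrite ler_powR//; lra.
  rewrite powRN powR_mulrn; last lra.
  by rewrite /L exprMn invfM exprVn invrK; lra.
rewrite /N ExD; last 2 first.
- by apply: bounded_mfun_sum => i; exact: bounded_mfun_indic.
- exact: bounded_mfun_indic.
rewrite Ex_sum => [|i]; last exact: bounded_mfun_indic.
have g1 : Ex P (\1_gap) <= m ^- 2 * expR (- m ^+ 2 / 2) by rewrite -lee_fin Ex_indic.
apply: (le_trans (lerD _ g1)).
  apply: (le_trans (ler_sum _ (fun i _ => lneq i))).
  by rewrite -mulr_sumr; apply: (ler_wpM2l _ suml); rewrite mulr_ge0.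
rewrite [leLHS](_ : _ = (16 * M + 1) * (m ^- 2 * expR (- m ^+ 2 / 2))); last by ring.
by rewrite ler_wpM2l//; [lra|rewrite ler_wpM2l].
Qed.

(** From [m ^+ 4 >= 2 * m ^+ 2], [eta] is at most the square of [expR (- m ^+ 2 / 2)]. One factor is
    below [2 * m ^- 2], the other below [expR (- x ^+ 2 / 2)]. *)
Let eta_le : eta <= 2 * (m ^- 2 * expR (- x ^+ 2 / 2)).
Proof.
have m4' := m4.
have m20 : 0 < m ^+ 2 by rewrite exprn_gt0//; lra.
have mx : expR (- m ^+ 2 / 2) <= expR (- x ^+ 2 / 2).
  rewrite ler_expR -(real_normK (num_real x)).
  by have := normr_ge0 x; move: xm; nra.
apply: (@le_trans _ _ (expR (- m ^+ 2 / 2) * expR (- m ^+ 2 / 2))).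
  rewrite -expRD ler_expR.
  have : 2 * m ^+ 2 <= m ^+ 2 * m ^+ 2 by rewrite ler_pM2r//; nra.
  by rewrite -exprD; lra.
rewrite mulrA ler_pM ?expR_ge0//.
rewrite mulNr expRN -[leRHS]invrK lef_pV2 ?posrE ?expR_gt0//; last first.
  by rewrite invr_gt0 mulr_gt0// invr_gt0.
rewrite invfM invrK; have := expR_ge1Dx (m ^+ 2 / 2); lra.
Qed.

(** The exponent is 24 = 19 + 3 + 2: [heat_const m (m ^- 8)] contains [m ^+ 19], the bound [sum_e]
    contains [m ^+ 3], and a factor [m ^- 2] must be left over. *)
Let th_small : th <= m ^- 24.
Proof.
have m24 : 0 < m ^+ 24 by rewrite exprn_gt0//; have := m4; lra.
by rewrite -[leLHS](mulKf (lt0r_neq0 m24)) ler_piMr// invr_ge0 ltW.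
Qed.

Let sum_l_ge0 : 0 <= \sum_(i <- s) l i.
Proof.
by apply: sumr_ge0 => i _; rewrite -absY; apply: Ex_ge0 => w; exact: powR_ge0.
Qed.

Let sum_e : \sum_(i <- s) e i <= (expR 1 + M) * m ^+ 3 * th.
Proof.
have p2' := p2; have m4' := m4; have M0' := M0.
have m3 : 1 <= m ^+ 3 by rewrite exprn_ege1//; lra.
have th0 : 0 < th by exact: expR_gt0.
rewrite /e /trunc_err big_split/= -!mulr_sumr 2!mulrDl lerD//.
  apply: (@le_trans _ _ (expR 1 * th)).
    by rewrite ler_piMr ?mulr_ge0 ?expR_ge0 ?(ltW th0)//; case/andP: sumv.
  by rewrite ler_wpM2r ?(ltW th0)// ler_peMr ?expR_ge0.
have thp : th `^ (- p) = expR (m ^+ 2 / 8).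
  rewrite /powR gt_eqF// expRK; congr expR; field; lra.
have Lm : L ^+ 3 <= m ^+ 3 by rewrite /L lerXn2r ?nnegrE//; lra.
apply: (@le_trans _ _ (m ^+ 3 * expR (m * L) * th `^ (- p) *
    (M * expR (- m ^+ 2 / 2)))).
  rewrite ler_pM// ?mulr_ge0 ?exprn_ge0 ?expR_ge0 ?powR_ge0//; try by rewrite /L; lra.
  apply: ler_wpM2r; first exact: powR_ge0.
  by apply: ler_wpM2r; first exact: expR_ge0.
rewrite thp [leLHS](_ : _ = M * m ^+ 3 *
  (expR (m * L) * expR (m ^+ 2 / 8) * expR (- m ^+ 2 / 2))); last by ring.
rewrite -!expRD; apply: ler_wpM2l; first exact: mulr_ge0 M0' (le_trans ler01 m3).
rewrite ler_expR /L invfM.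
have p1 : p^-1 <= 1 by rewrite invf_le1//; lra.
have := sqr_ge0 m; nra.
Qed.

Let heat_error y : `|y - x| <= 2 * m ^- 2 ->
  `|Ex P (fun w => heat (m ^- 8) (y - S w)) - gauss_tail x| <=
  (3 * expR 1 + 108 * expR 8 * (expR 1 + M)) * (m ^- 2 * expR (- x ^+ 2 / 2)).
Proof.
move=> yx; have m4' := m4; have xm' := xm; have M0' := M0; have mM' := mM.
have m1 : 1 <= m by lra.
have m0 : 0 < m by lra.
have eM0 : 0 <= expR 1 + M by rewrite addr_ge0 ?expR_ge0.
have th0 : 0 < th by exact: expR_gt0.
have L1 : 1 <= L by rewrite /L; lra.
have t01 : 0 < m ^- 8 <= 1.
  by rewrite invr_gt0 exprn_gt0//= invf_le1 ?exprn_ege1// exprn_gt0.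
have th01 : 0 < th <= 1.
  rewrite th0/= (le_trans th_small)// invf_le1 ?exprn_gt0// exprn_ege1//.
have mth : m * th <= 1.
  have := ler_wpM2l (ltW m0) th_small; move=> /le_trans; apply.
  rewrite exprS invfM mulrA mulfV ?gt_eqF// mul1r invf_le1 ?exprn_gt0//.
  exact: exprn_ege1.
have q1 : 0 < m^-1 <= 4^-1 by rewrite invr_gt0 m0/= lef_pV2 ?posrE.
have v0 i : 0 <= v i by rewrite -varY; apply: Ex_ge0 => w; exact: sqr_ge0.
have sv := sumv; have se := sum_e.
set V := \sum_(i <- s) v i in sv; set E := \sum_(i <- s) e i in se.
have tV2 : m ^- 8 + V <= 2 by case/andP: sv => _; case/andP: t01; lra.
have := @rv_sum_heat_le _ _ _ P I Z v e m x (m ^- 8)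
  (indep_trunc_rv L indY) (fun i => bounded_trunc_rv (Y i) (le_trans ler01 L1))
  m1 xm t01 v0 (fun i => trunc_var_sqr_le p2 m1 L1 th01 mth (iY2 i) (iYp i) (varY i) (absY i) (v1 i))
  (fun i => trunc_mean_le p2 m1 L1 th01 (iY i) (iYp i) (meanY i) (varY i) (absY i))
  (fun i => trunc_var_le p2 m1 L1 th01 (iY2 i) (iYp i) (varY i) (absY i))
  (fun i => trunc_cube_le p2 m1 L1 th01 mth (iY2 i) (iYp i) (varY i) (absY i))
  y s (m ^- 8) us (lexx _) tV2.
rewrite -/V -/E -/S => H1.
have E0 : 0 <= E by apply: sumr_ge0 => i _; exact: le_trans (sqr_ge0 _)
  (trunc_var_sqr_le p2 m1 L1 th01 mth (iY2 i) (iYp i) (varY i) (absY i) (v1 i)).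
have q20 : 0 <= m ^- 2 by rewrite invr_ge0 exprn_ge0// ltW.
have E22 : m ^+ 19 * E <= (expR 1 + M) * m ^- 2.
  apply: (@le_trans _ _ (m ^+ 19 * ((expR 1 + M) * m ^+ 3 * m ^- 24))).
    rewrite ler_wpM2l ?exprn_ge0 ?(ltW m0)// (le_trans se)//.
    by rewrite ler_wpM2l ?th_small// mulr_ge0// exprn_ge0// ltW.
  rewrite le_eqVlt; apply/predU1P; left; field; lra.
have E3 : 3 * m ^+ 3 * E <= 1.
  apply: (@le_trans _ _ (3 * (expR 1 + M) * m ^- 2 * m ^- 16)).
    rewrite -mulrA -!(mulrA 3) ler_wpM2l//.
    rewrite -(ler_pM2l (_ : 0 < m ^+ 16)) ?exprn_gt0//.
    rewrite mulrA -exprD (le_trans E22)// le_eqVlt; apply/predU1P; left; field; lra.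
  apply: (@le_trans _ _ (m * m ^- 2 * m ^- 16)).
    by rewrite !ler_wpM2r ?invr_ge0 ?exprn_ge0 ?(ltW m0).
  rewrite (_ : _ * _ = m ^- 17); last by field; lra.
  by rewrite invf_le1 ?exprn_gt0// exprn_ege1.
(* The tilt parameter is [x] itself. As [V <= 1], the exponent is at most [- x ^+ 2 / 2] plus three
   corrections: [x * (x - y) <= 2 / m], [x ^+ 2 * m ^- 8 / 2] and [3 * m ^+ 3 * E], each at most
   1. *)
have expo : expR (- x * y + x ^+ 2 * (m ^- 8 + V) / 2 + 3 * m ^+ 3 * E) <=
    expR 3 * expR (- x ^+ 2 / 2).
  rewrite -expRD ler_expR.
  have xy : `|x * (y - x)| <= 2 * m^-1.
    rewrite normrM (_ : 2 * m^-1 = m * (2 * m ^- 2)) ?ler_pM//.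
    by field; lra.
  rewrite -normrN in xy; have xy' := le_trans (ler_norm _) xy.
  have x2 : x ^+ 2 * m ^- 8 <= 1.
    rewrite -(real_normK (num_real x)) ler_pdivrMr ?exprn_gt0// mul1r.
    apply: (@le_trans _ _ (m ^+ 2)); last by rewrite ler_weXn2l.
    by rewrite lerXn2r ?nnegrE// ltW.
  have x2V : x ^+ 2 * V <= x ^+ 2.
    by rewrite ler_piMr ?sqr_ge0//; case/andP: sv.
  case/andP: q1 => _ q1; move: E3 xy' x2 x2V q1.
  set A := x ^+ 2 * m ^- 8; set B := 3 * m ^+ 3 * E.
  rewrite (_ : x ^+ 2 * (m ^- 8 + V) = A + x ^+ 2 * V); last by rewrite /A; ring.
  lra.
have H2 : `|heat (m ^- 8 + V) y - gauss_tail x| <= 3 * expR 1 * (m ^- 2 * expR (- x ^+ 2 / 2)).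
  apply: heat_gauss_tail => //.
  by case/andP: sv => ? ?; rewrite ler_norml; case/andP: t01 => ? ?; lra.
apply: le_trans (ler_distD _ _ _) _; apply: le_trans (lerD H1 H2) _.
rewrite [leRHS]mulrDl [leLHS]addrC lerD2l.
apply: (@le_trans _ _ (4 * heat_const m (m ^- 8) * E * (expR 3 * expR (- x ^+ 2 / 2)))).
  by rewrite ler_wpM2l// mulr_ge0// mulr_ge0// heat_const_ge0.
rewrite /heat_const isqrt_exprV//.
rewrite (_ : 4 * _ * E * _ = 108 * (expR 5 * expR 3) * (m ^+ 19 * E) * expR (- x ^+ 2 / 2)); last by ring.
rewrite -expRD (_ : 5 + 3 = 8 :> R); last by ring.
by rewrite [leRHS]mulrA ler_wpM2r ?expR_ge0// -[leRHS]mulrA ler_wpM2l//.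
Qed.

Theorem moderate_deviation_finite :
  `|fine (P [set w | x <= W w]) - gauss_tail x| <=
  (16 * M + 3 + 3 * expR 1 + 108 * expR 8 * (expR 1 + M)) *
  (m ^- 2 * expR (- x ^+ 2 / 2)).
Proof.
have m4' := m4.
have mWx : measurable [set w | x <= W w].
  rewrite (_ : [set w | _] = W @^-1` `[x, +oo[).
    by rewrite -[X in measurable X]setTI; exact: mW.
  by apply/seteqP; split => w /=; rewrite in_itv/= andbT.
have q0 : 0 <= m ^- 2 by rewrite invr_ge0 exprn_ge0//; lra.
have heat0 y : 0 <= heat (m ^- 8) y by exact: gauss_tail_ge0.
have heatle1 y : heat (m ^- 8) y <= 1 by exact: gauss_tail_le1.
have bh y : bounded_mfun (fun w => heat (m ^- 8) (y - S w)).
  split; last by exists 1 => w; rewrite ger0_norm.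
  apply: measurableT_comp (measurable_heat _) _.
  by apply: measurable_funB => //; exact: measurable_funPT.
have bc : @bounded_mfun _ T R (fun=> eta) by exact: bounded_mfun_cst.
have bW : bounded_mfun (\1_[set w | x <= W w] : T -> R) by exact: bounded_mfun_indic.
have eta0 : 0 <= eta by exact: expR_ge0.
have Ni w : 0 <= N w by rewrite addr_ge0 ?sumr_ge0//; move=> *; rewrite indicE.
have W01 w : 0 <= (\1_[set w | x <= W w] w : R) <= 1 by rewrite indicE lern1 leq_b1 ler0n.
(* The shift [2 * m ^- 2] is spent in halves: one covers the distance from [W] to the truncated sum
   when [N w = 0], the other brings the smoothed indicator within [eta] of its limit. When
   [N w >= 1], the term [N w] alone dominates the indicator. *)
have upper : Ex P (\1_[set w | x <= W w]) <=
    Ex P (fun w => heat (m ^- 8) (x - 2 * m ^- 2 - S w)) + eta + Ex P N.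
  rewrite -[eta](Ex_cst P) -!ExD//; last exact: bounded_mfunD.
  apply: Ex_le => // [|w]; first by do 2 apply: bounded_mfunD => //.
  have h0 := heat0 (x - 2 * m ^- 2 - S w).
  have [Nw|Nw] := N1 w; last by have := W01 w; lra.
  rewrite Nw addr0 indicE; have [|_] := boolP (w \in _); last by rewrite addr_ge0.
  rewrite inE/= => xW; have [SY WY] := N0 Nw.
  rewrite -SY in WY; have WS := le_trans (ler_norm _) WY.
  have : 1 - eta <= heat (m ^- 8) (x - 2 * m ^- 2 - S w).
    by apply: heat_ge; rewrite /S; lra.
  by rewrite /=; lra.
have lower : Ex P (fun w => heat (m ^- 8) (x + 2 * m ^- 2 - S w)) <=
    Ex P (\1_[set w | x <= W w]) + eta + Ex P N.
  rewrite -[eta](Ex_cst P) -!ExD//; last exact: bounded_mfunD.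
  apply: Ex_le => // [|w]; first by do 2 apply: bounded_mfunD => //.
  have h1 := heatle1 (x + 2 * m ^- 2 - S w).
  have [Nw|Nw] := N1 w; last by have := W01 w; lra.
  rewrite Nw addr0 indicE; have [|/negP xW] := boolP (w \in _).
    by move=> _; rewrite /=; lra.
  have [SY WY] := N0 Nw; rewrite -SY distrC in WY.
  have WS := le_trans (ler_norm _) WY; rewrite add0r.
  apply: heat_le; first lra.
  have : W w < x by rewrite ltNge; apply/negP => h; apply: xW; exact/mem_set.
  by rewrite /S; lra.
have q20 : 0 <= 2 * m ^- 2 by rewrite mulr_ge0.
have yx1 : `|x - 2 * m ^- 2 - x| <= 2 * m ^- 2.
  by rewrite addrAC subrr add0r normrN ger0_norm.
have yx2 : `|x + 2 * m ^- 2 - x| <= 2 * m ^- 2.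
  by rewrite addrAC subrr add0r ger0_norm.
rewrite -Ex_indic//=.
apply: le_trans (sandwich_le upper lower (heat_error yx1) (heat_error yx2) eta_le Ex_N) _.
by rewrite le_eqVlt; apply/predU1P; left; ring.
Qed.

End finite_sums.

(** * Linear random fields *)

Section expectation_product.
Context {d : measure_display} {T : measurableType d} {R : realType}.
Variable P : probability T R.
Variables X Y : {RV P >-> R}.
Hypothesis indXY : forall A B, measurable A -> measurable B ->
  P (X @^-1` A `&` Y @^-1` B) = (P (X @^-1` A) * P (Y @^-1` B))%E.
Hypotheses (iX : P.-integrable [set: T] (EFin \o X))
  (iY : P.-integrable [set: T] (EFin \o Y)).

Local Notation law := (distribution P X \x distribution P Y)%E.

Let XY : {mfun T >-> (R * R)%type} := mfun_Sub (mem_set (measurable_fun_XY X Y)).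

Let integral_XY (g : R * R -> \bar R) :
  (\int[distribution P XY]_z g z = \int[law]_z g z)%E.
Proof.
apply: eq_measure_integral => E mE _ /=.
have := @law_pair _ _ _ P X Y setT measurableT _ E mE.
rewrite setIT probability_setT mule1; apply=> A B mA mB.
by rewrite setIT mule1 indXY.
Qed.

Let f (z : R * R) : \bar R := (z.1 * z.2)%:E.

Let mf : measurable_fun [set: R * R] f.
Proof. by apply/measurable_EFinP; exact: measurable_funM. Qed.

Let mabsf : measurable_fun [set: R * R] (abse \o f).
Proof. exact: measurableT_comp. Qed.

Let integral_absf : (\int[law]_z `|f z| < +oo)%E.
Proof.
rewrite fubini_tonelli1//.
have mF := measurable_fun_fubini_tonelli_F (m2 := distribution P Y)
  (abse \o f) mabsf (fun=> abse_ge0 _).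
rewrite ge0_integral_distribution//; last first.
  by move=> x; apply: integral_ge0 => y _; exact: abse_ge0.
rewrite /fubini_F/=.
rewrite (_ : (\int[P]_w _)%E = (\int[P]_w (`|X w|%:E * \int[P]_w' `|Y w'|%:E))%E).
  rewrite ge0_integralZr//.
  - apply: lte_mul_pinfty; [exact: integral_ge0| |].
      by apply: integrable_fin_num => //; exact: integrable_normr.
    by have /integrableP[] := integrable_normr iY; rewrite /=;
      under eq_integral do rewrite normr_id.
  - by apply/measurable_EFinP; exact: measurableT_comp.
  - exact: integral_ge0.
apply: eq_integral => w _ /=.
rewrite -ge0_integralZl//; last by apply/measurable_EFinP; exact: measurableT_comp.
rewrite ge0_integral_distribution; last 2 first.
- have mg : measurable_fun [set: R] (fun y => X w * y) by exact: measurable_funM.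
  by apply/measurable_EFinP; exact: measurableT_comp mg.
- by move=> y; rewrite lee_fin.
by apply: eq_integral => w' _; rewrite /= normrM EFinM.
Qed.

(** The variables before truncation are only integrable and their product is signed, so Tonelli for
    the absolute value comes first, and Fubini for the product after it. *)
Lemma integrable_indep_mul : P.-integrable [set: T] (EFin \o (fun w => X w * Y w)).
Proof.
apply/integrableP; split.
  by apply/measurable_EFinP; exact: measurable_funM.
apply: le_lt_trans integral_absf; rewrite -integral_XY.
by rewrite ge0_integral_distribution//; move=> z; exact: abse_ge0.
Qed.

Lemma Ex_indep_mul : Ex P (fun w => X w * Y w) = Ex P X * Ex P Y.
Proof.
apply/EFin_inj; rewrite /Ex /Rintegral fineK; last first.
  exact: integrable_fin_num integrable_indep_mul.
transitivity (\int[distribution P XY]_z f z)%E.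
  by rewrite integral_distribution//; exact: integrable_indep_mul.
rewrite integral_XY -integral12_prod_meas1; last first.
  apply/integrableP; split; [exact: mf|exact: integral_absf].
have EYE x : (\int[distribution P Y]_y f (x, y) = x%:E * \int[P]_w (Y w)%:E)%E.
  rewrite integral_distribution.
  - by rewrite -integralZl.
  - by apply: (measurableT_comp mf); exact: measurable_fun_pair.
  - exact: integrable_scaler.
have EY : (\int[P]_w (Y w)%:E = (Ex P Y)%:E)%E.
  by rewrite fineK//; exact: integrable_fin_num iY.
transitivity (\int[distribution P X]_x (x%:E * (Ex P Y)%:E))%E.
  by apply: eq_integral => x _; rewrite -EY -EYE.
rewrite integral_distribution; last 2 first.
- by apply/measurable_EFinP; exact: measurable_funM.
- by apply: (integrableZr measurableT _ iX).
rewrite integralZr// EFinM; congr (_ * _)%E.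
by rewrite fineK//; exact: integrable_fin_num iX.
Qed.

End expectation_product.

Section random_variables.
Context {d : measure_display} {T : measurableType d} {R : realType}.
Context {P : probability T R}.
Implicit Types X Y : {RV P >-> R}.

Definition scale_rv (k : R) X : {RV P >-> R} :=
  mfun_Sub (mem_set (measurable_funM (measurable_cst k) (measurable_funPT X))).

Lemma scale_rvE k X w : scale_rv k X w = k * X w.
Proof. by []. Qed.

Lemma indep_scale_rv (I : choiceType) (k : I -> R) (X : I -> {RV P >-> R}) :
  indep_seq X -> indep_seq (fun i => scale_rv (k i) (X i)).
Proof.
move=> indX s B us mB; apply: (indX s (fun i => (fun r => k i * r) @^-1` B i)) => // i.
have mk : measurable_fun [set: R] (fun r => k i * r) by exact: measurable_funM.
by rewrite -[X in measurable X]setTI; exact: mk.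
Qed.

Lemma identically_distributed_Ex X Y (g : R -> R) :
  (forall B, measurable B -> distribution P X B = distribution P Y B) ->
  measurable_fun [set: R] g ->
  P.-integrable [set: T] (EFin \o (fun w => g (X w))) ->
  P.-integrable [set: T] (EFin \o (fun w => g (Y w))) /\
  Ex P (fun w => g (Y w)) = Ex P (fun w => g (X w)).
Proof.
move=> XY mg iX.
have mG : measurable_fun [set: R] (EFin \o g) by exact/measurable_EFinP.
have iY : P.-integrable [set: T] (EFin \o (fun w => g (Y w))).
  apply/integrableP; split.
    by apply/measurable_EFinP; exact: measurableT_comp.
  have /integrableP[_] := iX; apply: le_lt_trans.
  rewrite -(@ge0_integral_distribution _ _ _ _ _ P X (abse \o (EFin \o g)))//; last 2 first.
  - exact: measurableT_comp.
  - by move=> y; exact: abse_ge0.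
  rewrite -(@ge0_integral_distribution _ _ _ _ _ P Y (abse \o (EFin \o g)))//; last 2 first.
  - exact: measurableT_comp.
  - by move=> y; exact: abse_ge0.
  rewrite (@eq_measure_integral _ _ _ _ (distribution P X))// => A mA _.
  by apply/esym; exact: XY.
split=> //; rewrite /Ex /Rintegral; congr fine.
rewrite -(integral_distribution (X := X) (f := EFin \o g))//.
rewrite -(integral_distribution (X := Y) (f := EFin \o g))//.
by apply: eq_measure_integral => A mA _; apply/esym; exact: XY.
Qed.

Lemma integrable_le_abs (f g : T -> R) : measurable_fun [set: T] f ->
  P.-integrable [set: T] (EFin \o g) -> (forall w, `|f w| <= g w) ->
  P.-integrable [set: T] (EFin \o f).
Proof.
move=> mf ig fg; apply: le_integrable ig => //; first exact/measurable_EFinP.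
by move=> w _; rewrite /= lee_fin (le_trans (fg w))// ler_norm.
Qed.

Lemma integrable_Lnorm X (p : R) : 0 < p ->
  ('N[P]_(p%:E) [EFin \o X] < +oo)%E ->
  P.-integrable [set: T] (EFin \o (fun w => `|X w| `^ p)).
Proof.
move=> p0 NX; apply/integrableP; split.
  apply/measurable_EFinP; apply: (measurableT_comp (measurable_powR p)).
  exact: measurableT_comp.
move: NX; rewrite unlock /=.
rewrite (_ : (\int[P]_x _)%E = (\int[P]_x `|((fun w => `|X w| `^ p) x)%:E|)%E); last first.
  by apply: eq_integral => w _ /=; rewrite (ger0_norm (powR_ge0 _ _)).
set J := (\int[P]_x _)%E; have [->|] := eqVneq J +oo%E; last by move=> Jy _; rewrite ltey.
by rewrite poweRyr// invr_neq0// gt_eqF.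
Qed.

Lemma moments_integrable X (p : R) : 2 < p ->
  P.-integrable [set: T] (EFin \o (fun w => `|X w| `^ p)) ->
  P.-integrable [set: T] (EFin \o X) /\
  P.-integrable [set: T] (EFin \o (fun w => X w ^+ 2)).
Proof.
move=> p2 iXp.
have i1 : P.-integrable [set: T] (EFin \o (fun w => 1 + `|X w| `^ p)).
  by apply: integrable_addr => //; exact/bounded_mfun_integrable/bounded_mfun_cst.
split; apply: integrable_le_abs i1 _ => //.
- move=> w; have [X1|X1] := leP `|X w| 1; first by rewrite ler_wpDr ?powR_ge0.
  rewrite ler_wpDl// -[leLHS]powRr1// ler_powR ?(ltW X1)//; lra.
- exact: measurable_funX.
- move=> w; rewrite normrX; have [X1|X1] := leP `|X w| 1.
    by rewrite ler_wpDr ?powR_ge0// exprn_ile1.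
  by rewrite ler_wpDl// sqr_le_powR ?(ltW X1).
Qed.

End random_variables.

Section orthonormal_sums.
Context {d : measure_display} {T : measurableType d} {R : realType}.
Context {P : probability T R}.

(** In the expansion of the field sum, [coef_b] at [v] multiplies [xi (- v)]; hence the reindexing
    by negation. The index [None] lies outside [F], so the value of [C] there is only a default. *)
Lemma indep_seq_opp (xi0 : {RV P >-> R}) (xi : Z2 -> {RV P >-> R}) :
  mutually_independent (fun i : option Z2 => if i is Some v then xi v else xi0) ->
  indep_seq (fun v => xi (- v)).
Proof.
move=> ind s B us mB.
pose c (v : Z2) : option Z2 := Some (- v).
have cI : injective c by move=> u v /(congr1 (odflt 0)) /= /oppr_inj.
pose F : {fset option Z2} := seq_fset tt (map c s).
pose C (o : option Z2) : set R := if o is Some u then B (- u) else setT.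
have mC o : o \in F -> measurable (C o) by move=> _; case: o => [u|] /=; [exact: mB|exact: measurableT].
pose X (o : option Z2) : {RV P >-> R} := if o is Some v then xi v else xi0.
have -> : \bigcap_(v in [set` s]) (xi (- v) @^-1` B v) =
    \bigcap_(o in [set` F]) (X o @^-1` C o).
  apply/seteqP; split => w /= wF v.
    by rewrite /= seq_fsetE => /mapP[u us' ->] /=; rewrite opprK; exact: wF.
  by move=> vs; have := wF (c v); rewrite /= seq_fsetE map_f// opprK; exact.
rewrite (ind F C mC) (perm_big _ (seq_fset_perm tt _)) /=.
rewrite undup_id ?map_inj_uniq// big_map; apply: eq_bigr => v _ /=.
by rewrite opprK.
Qed.

Lemma integrable_sum_seq (I : Type) (f : I -> T -> R) (s : seq I) :
  (forall i, P.-integrable [set: T] (EFin \o f i)) ->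
  P.-integrable [set: T] (EFin \o (fun w => \sum_(i <- s) f i w)).
Proof.
move=> fi; elim: s => [|i s IH].
  rewrite (_ : (fun w => _) = (fun=> 0)).
    exact/bounded_mfun_integrable/bounded_mfun_cst.
  by apply/funext => w; rewrite big_nil.
rewrite (_ : (fun w => _) = (fun w => f i w + \sum_(j <- s) f j w)).
  exact: integrable_addr.
by apply/funext => w; rewrite big_cons.
Qed.

Lemma Ex_sum_integrable (I : Type) (f : I -> T -> R) (s : seq I) :
  (forall i, P.-integrable [set: T] (EFin \o f i)) ->
  Ex P (fun w => \sum_(i <- s) f i w) = \sum_(i <- s) Ex P (f i).
Proof.
move=> fi; elim: s => [|i s IH].
  by under eq_fun do rewrite big_nil; rewrite big_nil Ex_cst.
under eq_fun do rewrite big_cons.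
rewrite big_cons -IH /Ex RintegralD//.
exact: integrable_sum_seq.
Qed.

(** Independence and zero means remove all off-diagonal products. This is the isometry that reads L2
    norms of partial sums off the coefficients. *)
Lemma Ex_orthonormal_sqr (I : choiceType) (Y : I -> {RV P >-> R}) (c : I -> R) (s : seq I) :
  indep_seq Y -> uniq s ->
  (forall i, P.-integrable [set: T] (EFin \o Y i)) ->
  (forall i, P.-integrable [set: T] (EFin \o (fun w => Y i w ^+ 2))) ->
  (forall i, Ex P (Y i) = 0) -> (forall i, Ex P (fun w => Y i w ^+ 2) = 1) ->
  P.-integrable [set: T] (EFin \o (fun w => (\sum_(i <- s) c i * Y i w) ^+ 2)) /\
  Ex P (fun w => (\sum_(i <- s) c i * Y i w) ^+ 2) = \sum_(i <- s) c i ^+ 2.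
Proof.
move=> indY us iY iY2 EY EY2.
have YY i j : P.-integrable [set: T] (EFin \o (fun w => Y i w * Y j w)) /\
    Ex P (fun w => Y i w * Y j w) = (i == j)%:R.
  have [<-|ij] := eqVneq i j.
    split; first by have := iY2 i; under [X in EFin \o X]eq_fun do rewrite expr2.
    by rewrite -(EY2 i); congr (Ex P _); apply/funext => w; rewrite expr2.
  have indij (A B : set R) : measurable A -> measurable B ->
      P (Y i @^-1` A `&` Y j @^-1` B) = (P (Y i @^-1` A) * P (Y j @^-1` B))%E.
    move=> mA mB.
    have := indY [:: i; j] (fun k => if k == i then A else B).
    rewrite /= inE ij !big_cons big_nil mule1 eqxx eq_sym (negbTE ij) => <- //.
      congr (P _); apply/seteqP; split => w /=.
        move=> [wA wB] k /=; rewrite !inE => /orP[|] /eqP ->; rewrite ?eqxx//.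
        by rewrite eq_sym (negbTE ij).
      move=> wk; split; [have := wk i|have := wk j];
        by rewrite /= !inE eqxx ?orbT// 1?eq_sym ?(negbTE ij); apply.
    by move=> k; case: ifP.
  split; first exact: integrable_indep_mul.
  by rewrite Ex_indep_mul// !EY mul0r.
have sqrE w : (\sum_(i <- s) c i * Y i w) ^+ 2 =
    \sum_(i <- s) \sum_(j <- s) c i * c j * (Y i w * Y j w).
  rewrite expr2 big_distrlr/=; apply: eq_bigr => i _; apply: eq_bigr => j _; ring.
have iin i : P.-integrable [set: T]
    (EFin \o (fun w => \sum_(j <- s) c i * c j * (Y i w * Y j w))).
  by apply: integrable_sum_seq => j; apply: integrable_scaler; case: (YY i j).
under eq_fun do rewrite sqrE; split; first exact: integrable_sum_seq.
rewrite Ex_sum_integrable//; apply: eq_big_seq => i is_.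
rewrite Ex_sum_integrable; last first.
  by move=> j; apply: integrable_scaler; case: (YY i j).
rewrite (bigD1_seq i)//= big1 ?addr0.
  by rewrite /Ex RintegralZl//; case: (YY i i) => // _; rewrite /Ex => ->; rewrite eqxx mulr1 expr2.
move=> j ji; rewrite /Ex RintegralZl//; case: (YY i j) => // _; rewrite /Ex => ->.
by rewrite eq_sym (negbTE ji) mulr0.
Qed.

Lemma Lnorm2E (f : T -> R) :
  ('N[P]_(2%:E) [EFin \o f] = (\int[P]_w (f w ^+ 2)%:E) `^ 2^-1)%E.
Proof.
rewrite unlock; congr poweR; apply: eq_integral => w _ /=.
by rewrite powR_mulrn// real_normK// num_real.
Qed.

Lemma Lnorm2_Ex (f : T -> R) : P.-integrable [set: T] (EFin \o (fun w => f w ^+ 2)) ->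
  ('N[P]_(2%:E) [EFin \o f] = (Num.sqrt (Ex P (fun w => f w ^+ 2)))%:E)%E.
Proof.
move=> if2; rewrite Lnorm2E.
have -> : (\int[P]_w (f w ^+ 2)%:E = (Ex P (fun w => (f w ^+ 2)%R))%:E)%E.
  by rewrite fineK//; exact: integrable_fin_num if2.
by rewrite /= powR12_sqrt//; apply: Ex_ge0 => w; exact: sqr_ge0.
Qed.

Lemma Lnorm2_integrable (f : T -> R) : measurable_fun [set: T] f ->
  ('N[P]_(2%:E) [EFin \o f] < +oo)%E ->
  P.-integrable [set: T] (EFin \o (fun w => f w ^+ 2)).
Proof.
move=> mf; rewrite Lnorm2E => fy; apply/integrableP; split.
  by apply/measurable_EFinP; exact: measurable_funX.
rewrite (_ : (\int[P]_x _)%E = (\int[P]_w (f w ^+ 2)%:E)%E); last first.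
  by apply: eq_integral => w _ /=; rewrite ger0_norm ?sqr_ge0.
move: fy; set J := (\int[P]_x _)%E; have [->|] := eqVneq J +oo%E.
  by rewrite poweRyr// invr_neq0.
by move=> Jy _; rewrite ltey.
Qed.

End orthonormal_sums.

Section field_sums.
Context {d : measure_display} {T : measurableType d} {R : realType}.
Context {P : probability T R}.
Variables (a : Z2 -> R) (xi X : Z2 -> {RV P >-> R}).
Hypothesis X_linear : linear_random_field a xi X.

Let partial (g : seq Z2) (F : {fset Z2}) w : R :=
  \sum_(v <- F) (\sum_(u <- g) a (u + v)) * xi (- v) w.

Let measurable_partial g F : measurable_fun [set: T] (partial g F).
Proof.
by apply: measurable_sum => v; apply: measurable_funM.
Qed.

(** The series of the single [X u] are indexed differently; the translation by [u] turns
    [xi (u - v)] into [xi (- v)], so that one finite index set serves all terms of the sum. *)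
Lemma linear_field_approx (g : seq Z2) (eps : R) : 0 < eps ->
  exists F0 : {fset Z2}, forall F : {fset Z2}, (F0 `<=` F)%fset ->
  ('N[P]_(2%:E) [EFin \o (fun w => \sum_(u <- g) X u w - partial g F w)%R] < eps%:E)%E.
Proof.
elim: g eps => [|u g IH] eps eps0.
  exists fset0 => F _.
  rewrite (_ : _ \o _ = cst 0%E).
    by rewrite Lnorm0 ?lte_fin// eqe.
  apply/funext => w /=; rewrite big_nil /partial big1 ?subr0// => v _.
  by rewrite big_nil mul0r.
have e20 : 0 < eps / 2 by rewrite divr_gt0.
have [F1 hF1] := IH _ e20.
have : nbhs (0 : \bar R)%E [set y : \bar R | (y < (eps / 2)%:E)%E].
  by apply: open_nbhs_nbhs; split; [exact: open_ereal_lt_ereal|rewrite /= lte_fin].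
move=> /(X_linear u)[F2 _ hF2].
(* The translate of [F2] by [- u] is included so that [G], the translate of [F] by [u], contains
   [F2]. *)
exists (F1 `|` [fset (v - u)%R | v in F2])%fset => F; rewrite fsubUset => /andP[FF1 FF2].
pose G : {fset Z2} := [fset (u + v)%R | v in F]%fset.
have F2G : (F2 `<=` G)%fset.
  apply/fsubsetP => v vF2; apply/imfsetP; exists (v - u); last by rewrite /= subrKC.
  by apply: (fsubsetP FF2); apply/imfsetP; exists v.
have GE w : \sum_(v <- G) a v * xi (u - v) w = \sum_(v <- F) a (u + v) * xi (- v) w.
  rewrite big_imfset/=; last by move=> v v' _ _ /addrI.
  by apply: eq_bigr => v _; rewrite opprD addNKr.
have split_f : (fun w => \sum_(u' <- (u :: g)) X u' w - partial (u :: g) F w)%R =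
    ((fun w => X u w - \sum_(v <- G) a v * xi (u - v) w) \+
     (fun w => \sum_(u' <- g) X u' w - partial g F w))%R.
  apply/funext => w /=; rewrite big_cons GE /partial.
  rewrite (_ : \sum_(v <- F) (\sum_(u' <- (u :: g)) a (u' + v)) * xi (- v) w =
    \sum_(v <- F) a (u + v) * xi (- v) w + partial g F w); first by rewrite /partial; ring.
  rewrite /partial -big_split/=; apply: eq_bigr => v _.
  by rewrite big_cons mulrDl.
have m1 : measurable_fun [set: T]
    (fun w => X u w - \sum_(v <- G) a v * xi (u - v) w).
  by apply: measurable_funB => //; apply: measurable_sum => v; exact: measurable_funM.
have m2 : measurable_fun [set: T] (fun w => \sum_(u' <- g) X u' w - partial g F w).
  by apply: measurable_funB => //; exact: measurable_sum.
rewrite split_f; apply: le_lt_trans (minkowski_EFin P m1 m2 (ler1n R 2)) _.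
rewrite [X in (_ < X)%E](_ : _ = ((eps / 2)%:E + (eps / 2)%:E)%E); last first.
  by rewrite -EFinD; congr (_%:E); field.
apply: lteD; [exact: (hF2 G F2G)|exact: hF1].
Qed.

End field_sums.

Lemma ler_sum_subset (R : numDomainType) (I : eqType) (s F : seq I) (f : I -> R) :
  uniq s -> uniq F -> {subset s <= F} -> (forall i, 0 <= f i) ->
  \sum_(i <- s) f i <= \sum_(i <- F) f i.
Proof.
move=> us uF sF f0; rewrite [leRHS](bigID (mem s))/=.
have -> : \sum_(i <- F | i \in s) f i = \sum_(i <- s) f i.
  rewrite -big_filter; apply: perm_big; apply: uniq_perm => // [|i].
    exact: filter_uniq.
  by rewrite mem_filter/=; apply/andP/idP => [[]|is_]//; split=> //; exact: sF.
by rewrite lerDl sumr_ge0.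
Qed.

Section field_variance.
Context {d : measure_display} {T : measurableType d} {R : realType}.
Context {P : probability T R}.
Variables (a : Z2 -> R) (xi X : Z2 -> {RV P >-> R}) (Gamma : {fset Z2}).
Hypothesis X_linear : linear_random_field a xi X.
Hypothesis sigma_gt0 : 0 < sigma X Gamma.
Hypothesis ind_xi : indep_seq (fun v => xi (- v)).
Hypothesis ixi : forall v, P.-integrable [set: T] (EFin \o xi v).
Hypothesis ixi2 : forall v, P.-integrable [set: T] (EFin \o (fun w => xi v w ^+ 2)).
Hypotheses (Exi : forall v, Ex P (xi v) = 0)
  (Exi2 : forall v, Ex P (fun w => xi v w ^+ 2) = 1).

Let b := coef_b a Gamma.
Let S := field_sum X Gamma.
Let Tf (s : seq Z2) w := \sum_(v <- s) b v * xi (- v) w.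

Lemma measurable_field_sum : measurable_fun [set: T] (field_sum X Gamma).
Proof. exact: measurable_sum. Qed.

Let mTf s : measurable_fun [set: T] (Tf s).
Proof. by apply: measurable_sum => v; exact: measurable_funM. Qed.

Lemma sigma2_gt0 : 0 < sigma2 X Gamma.
Proof. by rewrite -sqrtr_gt0. Qed.

Lemma sqr_sigma : sigma X Gamma ^+ 2 = sigma2 X Gamma.
Proof. by rewrite sqr_sqrtr// ltW// sigma2_gt0. Qed.

(** Since [fine] sends infinite values to 0, a positive [sigma2] already forces the second moment to
    be finite. *)
Lemma integrable_field_sum_sqr :
  P.-integrable [set: T] (EFin \o (fun w => field_sum X Gamma w ^+ 2)).
Proof.
have := sigma2_gt0; rewrite /sigma2 unlock => s0.
apply/integrableP; split.
  by apply/measurable_EFinP; apply: measurable_funX; exact: measurable_field_sum.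
rewrite (_ : (\int[P]_x _)%E = (\int[P]_w (field_sum X Gamma w ^+ 2)%:E)%E); last first.
  by apply: eq_integral => w _ /=; rewrite ger0_norm ?sqr_ge0.
move: s0; set J := (\int[P]_w _)%E.
by case: J => [r| |] //=; rewrite ?ltry ?ltxx.
Qed.

Lemma Ex_field_sum_sqr : Ex P (fun w => field_sum X Gamma w ^+ 2) = sigma2 X Gamma.
Proof. by rewrite /sigma2 unlock. Qed.

Let NS : ('N[P]_(2%:E) [EFin \o S] = (sigma X Gamma)%:E)%E.
Proof. by rewrite Lnorm2_Ex ?Ex_field_sum_sqr//; exact: integrable_field_sum_sqr. Qed.

Let NT s : uniq s ->
  ('N[P]_(2%:E) [EFin \o Tf s] = (Num.sqrt (\sum_(v <- s) b v ^+ 2))%:E)%E.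
Proof.
move=> us; have [iT ET] := Ex_orthonormal_sqr b ind_xi us (fun v => ixi _)
  (fun v => ixi2 _) (fun v => Exi _) (fun v => Exi2 _).
by rewrite Lnorm2_Ex// ET.
Qed.

Let Lnorm2_sym (f g : T -> R) :
  ('N[P]_(2%:E) [EFin \o (fun w => f w - g w)%R] = 'N[P]_(2%:E) [EFin \o (fun w => g w - f w)%R])%E.
Proof.
by rewrite !Lnorm2E; congr poweR; apply: eq_integral => w _; rewrite -sqrrN opprB.
Qed.

Let approx (eps : R) : 0 < eps -> exists F0 : {fset Z2}, forall F : {fset Z2},
  (F0 `<=` F)%fset -> ('N[P]_(2%:E) [EFin \o (fun w => S w - Tf F w)%R] < eps%:E)%E.
Proof. by move=> eps0; exact: (linear_field_approx X_linear Gamma eps0). Qed.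

(** Bessel's inequality: [s] is enlarged to a set whose partial sum is within [eps] of the field sum
    in L2, which can only increase the sum of squares. *)
Lemma sum_coef_b_le (s : seq Z2) : uniq s ->
  \sum_(v <- s) coef_b a Gamma v ^+ 2 <= sigma2 X Gamma.
Proof.
move=> us; rewrite -sqr_sigma -[leLHS]sqr_sqrtr ?sumr_ge0//; last first.
  by move=> v _; exact: sqr_ge0.
rewrite lerXn2r ?nnegrE ?sqrtr_ge0 ?(ltW sigma_gt0)//.
apply/ler_addgt0Pr => eps eps0.
have [F0 hF0] := approx eps0.
pose F := (F0 `|` seq_fset tt s)%fset.
have sF : {subset s <= F} by move=> v vs; rewrite inE seq_fsetE vs orbT.
have {}hF0 := hF0 F (fsubsetUl _ _).
have uF : uniq F by exact: fset_uniq.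
apply: (@le_trans _ _ (Num.sqrt (\sum_(v <- F) b v ^+ 2))).
  by rewrite ler_sqrt; [|rewrite sumr_ge0// => v _; exact: sqr_ge0]; apply: ler_sum_subset => // v; exact: sqr_ge0.
rewrite -lee_fin -NT// (_ : Tf F = (S \+ (fun w => Tf F w - S w))%R); last first.
  by apply/funext => w /=; rewrite subrKC.
apply: le_trans (minkowski_EFin P measurable_field_sum
  (measurable_funB (mTf F) measurable_field_sum) (ler1n R 2)) _.
by rewrite NS (EFinD (sigma X Gamma)); apply: leeD2l; rewrite Lnorm2_sym ltW.
Qed.

Lemma field_sum_approx (eta : R) : 0 < eta <= 1 -> exists F : {fset Z2},
  [/\ (1 - eta) * sigma2 X Gamma <= \sum_(v <- F) coef_b a Gamma v ^+ 2,
   P.-integrable [set: T] (EFin \o (fun w => (S w - Tf F w) ^+ 2)) &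
   Ex P (fun w => (S w - Tf F w) ^+ 2) <= eta * sigma2 X Gamma].
Proof.
move=> /andP[eta0 eta1].
have s0 := sigma_gt0.
(* Half of [eta] is enough for both claims: [(1 - eta / 2) ^+ 2 >= 1 - eta] and
   [(eta / 2) ^+ 2 <= eta]. *)
have eps0 : 0 < eta * sigma X Gamma / 2 by rewrite divr_gt0// mulr_gt0.
have [F hF] := approx eps0.
have {}hF := hF F (fsubset_refl F).
have mD : measurable_fun [set: T] (fun w => S w - Tf F w).
  by apply: measurable_funB => //; exact: measurable_field_sum.
have iD : P.-integrable [set: T] (EFin \o (fun w => (S w - Tf F w) ^+ 2)).
  by apply: Lnorm2_integrable => //; apply: lt_trans hF _; rewrite ltry.
have ED0 : 0 <= Ex P (fun w => (S w - Tf F w) ^+ 2) by apply: Ex_ge0 => w; exact: sqr_ge0.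
exists F; split => //.
  have : sigma X Gamma <= Num.sqrt (\sum_(v <- F) b v ^+ 2) + eta * sigma X Gamma / 2.
    rewrite -lee_fin -NS (_ : S = (Tf F \+ (fun w => S w - Tf F w))%R); last first.
      by apply/funext => w /=; rewrite subrKC.
    apply: le_trans (minkowski_EFin P (mTf F) mD (ler1n R 2)) _.
    by rewrite NT ?fset_uniq// (EFinD (Num.sqrt _)); apply: leeD2l; rewrite ltW.
  rewrite -sqr_sigma; set q := Num.sqrt _ => sq.
  have q0 : 0 <= q by exact: sqrtr_ge0.
  have <- : q ^+ 2 = \sum_(v <- F) b v ^+ 2.
    by rewrite sqr_sqrtr// sumr_ge0// => v _; exact: sqr_ge0.
  have q1 : (1 - eta / 2) * sigma X Gamma <= q by lra.
  have e1 : 0 <= (1 - eta / 2) * sigma X Gamma by rewrite mulr_ge0//; [lra|exact: ltW].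
  apply: (@le_trans _ _ (((1 - eta / 2) * sigma X Gamma) ^+ 2)).
    rewrite exprMn ler_wpM2r ?sqr_ge0//; have := sqr_ge0 eta; lra.
  by rewrite lerXn2r ?nnegrE.
move: hF; rewrite Lnorm2_Ex// lte_fin => hF.
rewrite -[leLHS]sqr_sqrtr//.
apply: (@le_trans _ _ ((eta * sigma X Gamma / 2) ^+ 2)).
  by rewrite lerXn2r ?nnegrE ?sqrtr_ge0 ?(ltW eps0)// ltW.
rewrite -sqr_sigma (_ : (_ / 2) ^+ 2 = eta * (eta / 4) * sigma X Gamma ^+ 2); last by field.
rewrite ler_wpM2r ?sqr_ge0// ler_piMr ?(ltW eta0)//; lra.
Qed.

End field_variance.

(** * Norms of the coefficients and the size of [U] *)

Lemma esum_bounded (R : realType) (I : choiceType) (f : I -> R) (K : R) :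
  (forall i, 0 <= f i) ->
  (forall s : seq I, uniq s -> \sum_(i <- s) f i <= K) ->
  let d := fine (\esum_(i in [set: I]) (f i)%:E) in
  (forall s : seq I, uniq s -> \sum_(i <- s) f i <= d) /\ d <= K.
Proof.
move=> f0 fK d.
have sumE (s : seq I) : uniq s ->
    (\sum_(i <- s) f i)%:E = (\sum_(i \in [set` s]) (f i)%:E)%E.
  by move=> us; rewrite -fsbig_seq// sumEFin.
have up : (\esum_(i in [set: I]) (f i)%:E <= K%:E)%E.
  apply: ge_ereal_sup => _ [A [finA _] <-].
  by rewrite fsbig_finite//= sumEFin lee_fin fK// fset_uniq.
have lo s : uniq s -> ((\sum_(i <- s) f i)%:E <= \esum_(i in [set: I]) (f i)%:E)%E.
  move=> us; apply: ereal_sup_ubound; exists [set` s]; last by rewrite sumE.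
  by split => //; exact: finite_seq.
have fin : (\esum_(i in [set: I]) (f i)%:E)%E \is a fin_num.
  rewrite ge0_fin_numE; last by apply: esum_ge0 => i _; rewrite lee_fin.
  by apply: le_lt_trans up _; rewrite ltry.
have dE : (\esum_(i in [set: I]) (f i)%:E = d%:E)%E by rewrite fineK.
by split=> [s us|]; [rewrite -lee_fin -dE lo|rewrite -lee_fin -dE].
Qed.

Section coefficient_norms.
Context {R : realType}.
Variables (a : Z2 -> R) (Gamma : {fset Z2}) (s2 p : R).
Hypotheses (s20 : 0 < s2) (p2 : 2 < p).
Hypothesis sum_le : forall s : seq Z2, uniq s ->
  \sum_(v <- s) coef_b a Gamma v ^+ 2 <= s2.
Hypothesis sum_ge : forall eta : R, 0 < eta <= 1 -> exists F : {fset Z2},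
  (1 - eta) * s2 <= \sum_(v <- F) coef_b a Gamma v ^+ 2.

Let b := coef_b a Gamma.

Lemma powR_abs_sqr (x q : R) : `|x| `^ q = (x ^+ 2) `^ (q / 2).
Proof.
rewrite -(real_normK (num_real x)) -powR_mulrn// -powRrM; congr (_ `^ _).
by field.
Qed.

Let b2_le v : b v ^+ 2 <= s2.
Proof. by have := sum_le (s := [:: v]) isT; rewrite big_seq1. Qed.

Lemma D2E : D a Gamma 2 = s2.
Proof.
have sqrE v : `|b v| `^ 2 = b v ^+ 2 by rewrite powR_mulrn// real_normK// num_real.
have [|lo up] := @esum_bounded R Z2 (fun v => `|b v| `^ 2) s2 (fun v => powR_ge0 _ _).
  by move=> s us; under eq_bigr do rewrite sqrE; exact: sum_le.
apply/eqP; rewrite eq_le up/=.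
apply/ler_addgt0Pr => eps eps0.
pose eta := Num.min 1 (eps / s2).
have eta01 : 0 < eta <= 1 by rewrite lt_min ltr01 divr_gt0//= ge_min lexx.
have [F hF] := sum_ge eta01.
have : (1 - eta) * s2 <= D a Gamma 2.
  apply: (le_trans hF); apply: le_trans (lo F (fset_uniq F)).
  by under [leRHS]eq_bigr do rewrite sqrE.
have : eta * s2 <= eps by rewrite -ler_pdivlMr// ge_min lexx orbT.
lra.
Qed.

Lemma ratio_le_rho2 v : b v ^+ 2 / s2 <= rho2 a Gamma s2.
Proof.
apply: ub_le_sup; last by exists v.
by exists 1 => _ [u _ <-]; rewrite ler_pdivrMr// mul1r.
Qed.

Let rho0 : 0 <= rho2 a Gamma s2.
Proof. by apply: le_trans (ratio_le_rho2 0); rewrite divr_ge0 ?sqr_ge0 ?ltW. Qed.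

Let sum_p_le (s : seq Z2) : uniq s -> \sum_(v <- s) `|b v| `^ p <=
  rho2 a Gamma s2 `^ (p / 2 - 1) * s2 `^ (p / 2).
Proof.
have p2' := p2; move=> us.
have pE (x : R) : 0 <= x -> x `^ (p / 2) = x * x `^ (p / 2 - 1).
  move=> x0; rewrite -{2}(powRr1 x0) -powRD; first by congr (_ `^ _); field.
  by apply/implyP => /eqP; lra.
apply: (@le_trans _ _ (\sum_(v <- s) b v ^+ 2 * (rho2 a Gamma s2 * s2) `^ (p / 2 - 1))).
  apply: ler_sum => v _; rewrite powR_abs_sqr pE ?sqr_ge0// ler_wpM2l ?sqr_ge0//.
  rewrite ge0_ler_powR ?nnegrE ?sqr_ge0 ?mulr_ge0 ?(ltW s20)//; first lra.
  by rewrite -ler_pdivrMr// ratio_le_rho2.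
rewrite -mulr_suml powRM ?(ltW s20)// [leRHS]mulrC (pE s2) ?(ltW s20)// -mulrA.
rewrite ler_pM ?sumr_ge0 ?mulr_ge0 ?powR_ge0 ?sum_le//; last by rewrite mulrC.
by move=> v _; exact: sqr_ge0.
Qed.

Lemma sum_normalized_le_U (s : seq Z2) : uniq s ->
  \sum_(v <- s) `|b v / Num.sqrt s2| `^ p <= U a Gamma p.
Proof.
move=> us; rewrite /U D2E.
have [lo _] := esum_bounded (fun v => powR_ge0 `|b v| p) sum_p_le.
apply: le_trans (_ : s2 `^ (- (p / 2)) * \sum_(v <- s) `|b v| `^ p <= _); last first.
  by rewrite ler_wpM2l ?powR_ge0// lo.
rewrite mulr_sumr; apply: ler_sum => v _.
rewrite !powR_abs_sqr expr_div_n sqr_sqrtr ?(ltW s20)// powRM ?sqr_ge0 ?invr_ge0 ?(ltW s20)//.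
by rewrite -(powR_inv1 (ltW s20)) -powRrM mulN1r mulrC.
Qed.

(** This is how the hypothesis on [rho2] is used: it drives [U] to 0, hence [m] to infinity. *)
Lemma U_le_rho2 : U a Gamma p <= rho2 a Gamma s2 `^ (p / 2 - 1).
Proof.
rewrite /U D2E.
have [_ up] := esum_bounded (fun v => powR_ge0 `|b v| p) sum_p_le.
apply: le_trans (ler_wpM2l (powR_ge0 _ _) up) _.
rewrite mulrCA -powRD ?subrr; last by rewrite (gt_eqF s20) implybT.
by rewrite addNr powRr0 mulr1.
Qed.

Lemma U_gt0 : 0 < U a Gamma p.
Proof.
rewrite /U D2E mulr_gt0 ?powR_gt0//.
have [lo _] := esum_bounded (fun v => powR_ge0 `|b v| p) sum_p_le.
have [v bv] : exists v, b v != 0.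
  apply: contrapT => nb.
  (* If all coefficients vanished, [sum_ge] at 1/2 would give [s2 / 2 <= 0]. *)
  have half : 0 < (2^-1 : R) <= 1 by lra.
  have [F] := sum_ge half; rewrite big1; last first.
    move=> v _; apply/eqP; rewrite sqrf_eq0; apply: contrapT => bv; apply: nb.
    by exists v; apply/negP.
  by have := s20; lra.
apply: lt_le_trans (lo [:: v] isT); rewrite big_seq1.
by rewrite powR_gt0// normr_gt0.
Qed.

End coefficient_norms.

(** * Explicit error bound for one index set *)

Section tail_estimate.
Context {d : measure_display} {T : measurableType d} {R : realType}.
Context {P : probability T R}.
Variables (a : Z2 -> R) (xi X : Z2 -> {RV P >-> R}) (Gamma : {fset Z2}).
Variables (p M m x sg : R).
Hypothesis X_linear : linear_random_field a xi X.
Hypothesis sigma_gt0 : 0 < sigma X Gamma.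
Hypothesis ind_xi : indep_seq (fun v => xi (- v)).
Hypotheses (p2 : 2 < p)
  (ixip : forall v, P.-integrable [set: T] (EFin \o (fun w => `|xi v w| `^ p)))
  (Exi : forall v, Ex P (xi v) = 0)
  (Exi2 : forall v, Ex P (fun w => xi v w ^+ 2) = 1)
  (Exip : forall v, Ex P (fun w => `|xi v w| `^ p) = M).
Hypothesis sg1 : `|sg| = 1.
Hypotheses (xm : `|x| <= m) (mU : U a Gamma p = expR (- m ^+ 2 / 2)).
Hypotheses (m4 : 4 <= m) (mM : 3 * (expR 1 + M) <= m)
  (mlarge : m ^+ 24 * expR (- m ^+ 2 / (8 * p)) <= 1).

Let ixi v : P.-integrable [set: T] (EFin \o xi v).
Proof. by have [] := moments_integrable p2 (ixip v). Qed.

Let ixi2 v : P.-integrable [set: T] (EFin \o (fun w => xi v w ^+ 2)).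
Proof. by have [] := moments_integrable p2 (ixip v). Qed.

Let s := sigma X Gamma.
Let k v := sg * (coef_b a Gamma v / s).
Let Y v := scale_rv (k v) (xi (- v)).
Let W w := sg * (field_sum X Gamma w / s).

Let sqr_sg : sg ^+ 2 = 1.
Proof. by rewrite -(real_normK (num_real sg)) sg1 expr1n. Qed.

Let sqr_k v : k v ^+ 2 = coef_b a Gamma v ^+ 2 / sigma2 X Gamma.
Proof. by rewrite exprMn sqr_sg mul1r expr_div_n sqr_sigma. Qed.

Let sum_k_le (F : seq Z2) : uniq F -> \sum_(v <- F) k v ^+ 2 <= 1.
Proof.
move=> uF; under eq_bigr do rewrite sqr_k.
rewrite -mulr_suml ler_pdivrMr ?sigma2_gt0// mul1r.
exact: (sum_coef_b_le X_linear sigma_gt0 ind_xi ixi ixi2 Exi Exi2).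
Qed.

Let absk v : `|k v| = `|coef_b a Gamma v / Num.sqrt (sigma2 X Gamma)|.
Proof. by rewrite normrM sg1 mul1r. Qed.

Let M0 : 0 <= M.
Proof. by rewrite -(Exip 0); apply: Ex_ge0 => w; exact: powR_ge0. Qed.

(** The sign [sg] is absorbed into the coefficients [k], which enter the moment conditions only
    through [k ^+ 2] and [|k|]. *)
Lemma normalized_tail_estimate :
  `|fine (P [set w | x <= sg * (field_sum X Gamma w / sigma X Gamma)]) - gauss_tail x| <=
  (16 * M + 3 + 3 * expR 1 + 108 * expR 8 * (expR 1 + M)) *
  (m ^- 2 * expR (- x ^+ 2 / 2)).
Proof.
have m1 : 1 <= m by have := m4; lra.
have m0 : 0 < m by lra.
have s0 : 0 < s by exact: sigma_gt0.
(* One choice for two needs: the variance defect stays below [m ^- 8], and Chebyshev at distance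
   [m ^- 2], which costs [m ^+ 4], leaves [m ^- 4 * expR (- m ^+ 2 / 2)]. *)
pose eta := m ^- 8 * expR (- m ^+ 2 / 2).
have q8 : 0 < m ^- 8 <= 1.
  by rewrite invr_gt0 exprn_gt0//= invf_le1 ?exprn_gt0// exprn_ege1.
have e1 : expR (- m ^+ 2 / 2) <= 1.
  by rewrite -[leRHS]expR0 ler_expR; have := sqr_ge0 m; lra.
have eta01 : 0 < eta <= 1.
  case/andP: q8 => q80 q81; rewrite mulr_gt0 ?expR_gt0//=.
  by rewrite mulr_ile1 ?expR_ge0// ltW.
have [F [sumF iD ED]] :=
  field_sum_approx X_linear sigma_gt0 ind_xi ixi ixi2 Exi Exi2 eta01.
have indY : indep_seq Y by exact: indep_scale_rv.
have powY v w : `|Y v w| `^ p = `|k v| `^ p * `|xi (- v) w| `^ p.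
  by rewrite scale_rvE normrM powRM.
have sqrY v w : Y v w ^+ 2 = k v ^+ 2 * xi (- v) w ^+ 2.
  by rewrite scale_rvE exprMn.
have iY v : P.-integrable [set: T] (EFin \o Y v) by exact: integrable_scaler.
have iY2 v : P.-integrable [set: T] (EFin \o (fun w => Y v w ^+ 2)).
  by under eq_fun do rewrite sqrY; exact: integrable_scaler.
have iYp v : P.-integrable [set: T] (EFin \o (fun w => `|Y v w| `^ p)).
  by under eq_fun do rewrite powY; exact: integrable_scaler.
have EY v : Ex P (Y v) = 0 by rewrite /Ex RintegralZl// -/(Ex P _) Exi mulr0.
have EY2 v : Ex P (fun w => Y v w ^+ 2) = k v ^+ 2.
  under eq_fun do rewrite sqrY.
  by rewrite /Ex RintegralZl// -/(Ex P _) Exi2 mulr1.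
have EYp v : Ex P (fun w => `|Y v w| `^ p) = `|k v| `^ p * M.
  under eq_fun do rewrite powY.
  by rewrite /Ex RintegralZl// -/(Ex P _) Exip.
have mW : measurable_fun [set: T] W.
  by apply: measurable_funM => //; apply: measurable_funM => //; exact: measurable_field_sum.
have gapE w : W w - \sum_(v <- F) Y v w =
    sg / s * (field_sum X Gamma w - \sum_(v <- F) coef_b a Gamma v * xi (- v) w).
  rewrite mulrBr /W mulrA mulrAC; congr (_ - _).
  by rewrite mulr_sumr; apply: eq_bigr => v _; rewrite scale_rvE /k; ring.
have mgap : measurable [set w | m ^- 2 < `|W w - \sum_(v <- F) Y v w|].
  have mD : measurable_fun [set: T] (fun w => `|W w - \sum_(v <- F) Y v w|).
    apply: measurableT_comp => //; apply: measurable_funB => //.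
    exact: measurable_fun_rv_sum.
  rewrite (_ : [set w | _] = (fun w => `|W w - \sum_(v <- F) Y v w|) @^-1` `]m ^- 2, +oo[).
    by rewrite -[X in measurable X]setTI; exact: mD.
  by apply/seteqP; split => w /=; rewrite in_itv/= andbT.
apply: (@moderate_deviation_finite _ _ _ P Z2 Y W (fun v => k v ^+ 2)
  (fun v => `|k v| `^ p * M) p m M x F) => //.
- by move=> v; have := sum_k_le (F := [:: v]) isT; rewrite big_seq1.
- rewrite sum_k_le ?fset_uniq// andbT.
  under eq_bigr do rewrite sqr_k.
  rewrite -mulr_suml ler_pdivlMr ?sigma2_gt0//; apply: le_trans sumF.
  rewrite ler_wpM2r ?(ltW (sigma2_gt0 _))// lerD2l lerN2 ler_piMr//.
  by case/andP: q8 => /ltW.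
- rewrite -mulr_suml mulrC ler_wpM2l//.
  under eq_bigr do rewrite absk.
  rewrite -mU; apply: sum_normalized_le_U => //; first exact: sigma2_gt0.
  + exact: (sum_coef_b_le X_linear sigma_gt0 ind_xi ixi ixi2 Exi Exi2).
  + move=> eta' /(field_sum_approx X_linear sigma_gt0 ind_xi ixi ixi2 Exi Exi2)[F' [? _ _]].
    by exists F'.
  + exact: fset_uniq.
- rewrite -Ex_indic// lee_fin.
  pose D w := field_sum X Gamma w - \sum_(v <- F) coef_b a Gamma v * xi (- v) w.
  apply: (@le_trans _ _ (Ex P (fun w => m ^+ 4 / sigma2 X Gamma * D w ^+ 2))).
    apply: le_Rintegral => // [||w _].
    + exact/bounded_mfun_integrable/bounded_mfun_indic.
    + exact: integrable_scaler.
    rewrite indicE; have [|_] := boolP (w \in _); last first.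
      by rewrite mulr_ge0 ?sqr_ge0 ?divr_ge0 ?exprn_ge0 ?(ltW m0) ?(ltW (sigma2_gt0 _)).
    rewrite inE/= gapE => gap.
    have : (m ^- 2) ^+ 2 <= (sg / s * D w) ^+ 2.
      rewrite -(real_normK (num_real (sg / s * D w))) lerXn2r ?nnegrE ?invr_ge0 ?exprn_ge0 ?(ltW m0)//.
      exact: ltW gap.
    rewrite exprMn expr_div_n sqr_sg sqr_sigma// mul1r.
    move=> /(ler_wpM2l (exprn_ge0 4 (ltW m0))).
    by rewrite -exprVn -exprM exprVn mulfV ?mulrA// expf_neq0// gt_eqF.
  rewrite /Ex RintegralZl// -/(Ex P _).
  apply: (@le_trans _ _ (m ^+ 4 / sigma2 X Gamma * (eta * sigma2 X Gamma))).
    rewrite ler_wpM2l// divr_ge0 ?exprn_ge0 ?(ltW m0) ?(ltW (sigma2_gt0 _))//.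
  rewrite [leLHS](_ : _ = m ^- 4 * expR (- m ^+ 2 / 2)); last first.
    rewrite /eta; move: (expR _) => E; field; rewrite (gt_eqF (sigma2_gt0 _))//.
    by rewrite gt_eqF.
  by rewrite ler_wpM2r ?expR_ge0// inv_exp_le.
Qed.

End tail_estimate.

(** * Passage to the limit *)

Lemma exprn_expR_le1 (R : realType) (p : R) : 0 < p ->
  exists m0 : R, forall m, m0 <= m -> m ^+ 24 * expR (- m ^+ 2 / (8 * p)) <= 1.
Proof.
move=> p0; exists (1 + 26 * (8 * p)) => m mm.
have p80 : 0 < 8 * p by rewrite mulr_gt0.
have m1 : 1 <= m by lra.
have m0 : 0 <= m by lra.
rewrite mulNr expRN ler_pdivrMr ?expR_gt0// mul1r.
apply: (@le_trans _ _ (m ^+ 26)); first by rewrite ler_weXn2l.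
(* The exponential is written as a 26th power whose base is at least [m ^+ 2 / (26 * (8 * p)) >= m];
   any exponent from 24 on would serve. *)
rewrite (_ : m ^+ 2 / (8 * p) = 26%:R * (m ^+ 2 / (26 * (8 * p)))); last first.
  by field; lra.
rewrite expRM_natl lerXn2r ?nnegrE ?expR_ge0//.
apply: le_trans (expR_ge1Dx _).
apply: (@le_trans _ _ (m ^+ 2 / (26 * (8 * p)))); last by rewrite lerDr.
by rewrite ler_pdivlMr ?mulr_gt0// expr2 ler_wpM2l//; lra.
Qed.

Lemma gauss_tail_gt0 (R : realType) (x : R) : 0 < gauss_tail x.
Proof.
have := @gauss_tail_lower R (Num.max 1 `|x|) x.
rewrite !le_max !lexx orbT => /(_ isT isT); apply: lt_le_trans.
by rewrite !mulr_gt0 ?expR_gt0 ?normal_peak_gt0 ?oner_eq0// invr_gt0 lt_max ltr01.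
Qed.

Lemma relative_error_le (R : realType) (m x K q e : R) : 1 <= m -> `|x| <= m ->
  0 < e -> K / (normal_peak 1 * expR (- (3 / 2)) * e) <= m ->
  `|q - gauss_tail x| <= K * (m ^- 2 * expR (- x ^+ 2 / 2)) ->
  `|q / gauss_tail x - 1| <= e.
Proof.
move=> m1 xm e0 Km hq.
have m0 : 0 < m by lra.
have c0 : 0 < normal_peak 1 * expR (- (3 / 2)) :> R.
  by rewrite mulr_gt0 ?expR_gt0 ?normal_peak_gt0 ?oner_eq0.
have Q0 := gauss_tail_gt0 x; have Ql := gauss_tail_lower m1 xm.
set c := normal_peak 1 * _ in c0 Km Ql.
have E0 : 0 < expR (- x ^+ 2 / 2) by exact: expR_gt0.
set Q := gauss_tail x in Q0 Ql hq *; set E := expR _ in E0 Ql hq.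
rewrite -(divff (lt0r_neq0 Q0)) -mulrBl normrM (@gtr0_norm _ Q^-1) ?invr_gt0//.
rewrite ler_pdivrMr//; apply: (le_trans hq).
apply: (@le_trans _ _ (e * (c * (E / m)))); last by rewrite ler_wpM2l// ltW.
move: Km; rewrite ler_pdivrMr ?(mulr_gt0 c0 e0)// => Km.
rewrite (_ : e * _ = (m * (c * e)) * (m ^- 2 * E)); last by field; rewrite gt_eqF.
by rewrite ler_wpM2r// mulr_ge0 ?invr_ge0 ?exprn_ge0 ?ltW.
Qed.

Lemma U_level (R : realType) (u : R) : 0 < u -> u <= 1 ->
  u = expR (- Num.sqrt (2 * ln (u^-1)) ^+ 2 / 2).
Proof.
move=> u0 u1; rewrite sqr_sqrtr; last first.
  by rewrite mulr_ge0// lnV ?posrE// oppr_ge0 ln_le0.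
by rewrite lnV ?posrE// mulrN opprK mulrAC divff// mul1r lnK.
Qed.

Section normalized_tail_asymptotics.
Context {d : measure_display} {T : measurableType d} {R : realType}.
Variable P : probability T R.
Variables (a : Z2 -> R) (xi0 : {RV P >-> R}) (xi X : Z2 -> {RV P >-> R}).
Hypothesis xi_iid : iid (fun i : option Z2 => if i is Some v then xi v else xi0).
Hypotheses (xi0_mean : ('E_P[xi0] = 0)%E)
  (xi0_var : ('E_P[(fun w => xi0 w ^+ 2)%R] = 1)%E).
Hypothesis X_linear : linear_random_field a xi X.
Variable Gamma : nat -> {fset Z2}.
Hypothesis sigma_gt0 : forall n, 0 < sigma X (Gamma n).
Variable p : R.
Hypotheses (p_gt2 : 2 < p) (xi0_Lp : ('N[P]_(p%:E) [EFin \o xi0] < +oo)%E).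
Hypothesis rho_to0 :
  rho2 a (Gamma n) (sigma2 X (Gamma n)) @[n --> \oo] --> (0 : R).
Variable x : nat -> R.
Hypothesis x_le : forall n, x n ^+ 2 <= 2 * ln ((U a (Gamma n) p)^-1).

Lemma normalized_tail_asymptotics (sg : R) : `|sg| = 1 ->
  exists2 eps : nat -> R, eps n @[n --> \oo] --> (0 : R) &
  forall n, P [set w | x n <= sg * (field_sum X (Gamma n) w / sigma X (Gamma n))] =
    (gauss_tail (x n) * (1 + eps n))%:E.
Proof.
move=> sg1; have p2 := p_gt2; have p0 : 0 < p by lra.
case: xi_iid => xi_ind xi_id.
have ixi0p := integrable_Lnorm p0 xi0_Lp.
have [ixi0 ixi02] := moments_integrable p_gt2 ixi0p.
have same v B : measurable B -> distribution P xi0 B = distribution P (xi v) B.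
  by move=> mB; exact: (xi_id None (Some v)).
have mp : measurable_fun [set: R] (fun r => `|r| `^ p).
  by apply: (measurableT_comp (measurable_powR p)); exact: normr_measurable.
have m2 : measurable_fun [set: R] (fun r : R => r ^+ 2) by exact: measurable_funX.
have mid : measurable_fun [set: R] (fun r : R => r) by exact: measurable_id.
set M := Ex P (fun w => `|xi0 w| `^ p).
have Exi v : Ex P (xi v) = 0.
  have [_ ->] := identically_distributed_Ex (same v) mid ixi0.
  by have := xi0_mean; rewrite unlock /Ex /Rintegral => ->.
have Exi2 v : Ex P (fun w => xi v w ^+ 2) = 1.
  have [_ ->] := identically_distributed_Ex (same v) m2 ixi02.
  by have := xi0_var; rewrite unlock /Ex /Rintegral => ->.
have ixip v : P.-integrable [set: T] (EFin \o (fun w => `|xi v w| `^ p)).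
  by have [] := identically_distributed_Ex (same v) mp ixi0p.
have Exip v : Ex P (fun w => `|xi v w| `^ p) = M.
  by have [_ ->] := identically_distributed_Ex (same v) mp ixi0p.
have ind_xi := indep_seq_opp xi_ind.
have ixi v : P.-integrable [set: T] (EFin \o xi v).
  by have [] := moments_integrable p_gt2 (ixip v).
have ixi2 v : P.-integrable [set: T] (EFin \o (fun w => xi v w ^+ 2)).
  by have [] := moments_integrable p_gt2 (ixip v).
pose A n := [set w | x n <= sg * (field_sum X (Gamma n) w / sigma X (Gamma n))].
have mA n : measurable (A n).
  have mW : measurable_fun [set: T]
      (fun w => sg * (field_sum X (Gamma n) w / sigma X (Gamma n))).
    apply: measurable_funM => //; apply: measurable_funM => //.
    exact: measurable_field_sum.
  rewrite (_ : A n = (fun w => sg * (field_sum X (Gamma n) w / sigma X (Gamma n))) @^-1`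
      `[x n, +oo[).
    by rewrite -[X in measurable X]setTI; exact: mW.
  by apply/seteqP; split => w /=; rewrite in_itv/= andbT.
exists (fun n => fine (P (A n)) / gauss_tail (x n) - 1); last first.
  move=> n; rewrite subrKC mulrC divfK ?fineK ?fin_num_measure//.
  by rewrite gt_eqF// gauss_tail_gt0.
have s20 n : 0 < sigma2 X (Gamma n) by exact: sigma2_gt0.
have sumle n (s : seq Z2) : uniq s ->
    \sum_(v <- s) coef_b a (Gamma n) v ^+ 2 <= sigma2 X (Gamma n).
  exact: (sum_coef_b_le X_linear (sigma_gt0 n) ind_xi ixi ixi2 Exi Exi2).
have sumge n (eta : R) : 0 < eta <= 1 -> exists F : {fset Z2},
    (1 - eta) * sigma2 X (Gamma n) <= \sum_(v <- F) coef_b a (Gamma n) v ^+ 2.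
  move=> /(field_sum_approx X_linear (sigma_gt0 n) ind_xi ixi ixi2 Exi Exi2)[F [? _ _]].
  by exists F.
have [m0 hm0] := exprn_expR_le1 p0.
apply/cvgr0Pnorm_le => e e0.
set K := 16 * M + 3 + 3 * expR 1 + 108 * expR 8 * (expR 1 + M).
pose c := K / (normal_peak 1 * expR (- (3 / 2)) * e).
(* The thresholds for [m]: 4 and [3 * (expR 1 + M)] for the finite estimate, [m0] for the
   exponential to beat the 24th power, [c] for a relative error at most [e]. *)
pose m1 := Num.max (Num.max 4 (3 * (expR 1 + M))) (Num.max m0 c).
have m14 : 4 <= m1 by rewrite !le_max lexx.
have q0 : 0 < p / 2 - 1 by lra.
pose r0 := expR (- m1 ^+ 2 / 2) `^ (p / 2 - 1)^-1.
have r00 : 0 < r0 by rewrite powR_gt0 ?expR_gt0.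
have /cvgr0Pnorm_le/(_ _ r00) := rho_to0.
apply: filterS => n rho_small.
have rho0 : 0 <= rho2 a (Gamma n) (sigma2 X (Gamma n)).
  apply: le_trans (ratio_le_rho2 (s20 n) (sumle n) 0).
  by rewrite divr_ge0 ?sqr_ge0 ?ltW.
have Un0 : 0 < U a (Gamma n) p by exact: U_gt0 (s20 n) p_gt2 (sumle n) (sumge n).
have Un1 : U a (Gamma n) p <= expR (- m1 ^+ 2 / 2).
  apply: le_trans (U_le_rho2 (s20 n) p_gt2 (sumle n) (sumge n)) _.
  rewrite ger0_norm// in rho_small.
  have -> : expR (- m1 ^+ 2 / 2) = r0 `^ (p / 2 - 1).
    by rewrite -powRrM mulVf ?gt_eqF// powRr1 ?expR_ge0.
  by rewrite ge0_ler_powR ?nnegrE ?powR_ge0 ?(ltW q0).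
have Ule1 : U a (Gamma n) p <= 1.
  apply: le_trans Un1 _; rewrite -[leRHS]expR0 ler_expR.
  by have := sqr_ge0 m1; lra.
set m := Num.sqrt (2 * ln ((U a (Gamma n) p)^-1)).
have mU : U a (Gamma n) p = expR (- m ^+ 2 / 2) by exact: U_level.
have mm1 : m1 <= m.
  have := Un1; rewrite [leLHS]mU ler_expR => mm.
  have m2le : m1 ^+ 2 <= m ^+ 2 by lra.
  have m10 : 0 <= m1 by lra.
  by rewrite -(@ler_pXn2r _ 2)// ?nnegrE ?sqrtr_ge0.
have xm : `|x n| <= m.
  by rewrite -sqrtr_sqr ler_wsqrtr.
move: mm1; rewrite !ge_max => /andP[/andP[m4 mM] /andP[m0m cm]].
apply: (relative_error_le _ xm e0 cm); first lra.
exact: (normalized_tail_estimate X_linear (sigma_gt0 n) ind_xi p_gt2 ixip Exi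
  Exi2 Exip sg1 xm mU m4 mM (hm0 _ m0m)).
Qed.

End normalized_tail_asymptotics.

Unset Implicit Arguments.
Set Strict Implicit.
Set Printing Implicit Defensive.

Theorem theorem2p1 (d : measure_display) (T : measurableType d) (R : realType)
    (P : probability T R)
    (a : Z2 -> R) (a_square_summable : summable [set: Z2] (fun v => (a v ^+ 2)%:E))
    (xi0 : {RV P >-> R}) (xi : Z2 -> {RV P >-> R})
    (xi_iid : iid (fun i : option Z2 => if i is Some v then xi v else xi0))
    (xi0_mean : ('E_P[xi0] = 0)%E)
    (xi0_var : ('E_P[(fun w => xi0 w ^+ 2)%R] = 1)%E)
    (X : Z2 -> {RV P >-> R}) (X_linear : linear_random_field a xi X)
    (Gamma : nat -> {fset Z2})
    (sigma_gt0 : forall n, 0 < sigma X (Gamma n))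
    (p : R) (p_gt2 : 2 < p)
    (xi0_Lp : ('N[P]_(p%:E) [EFin \o xi0] < +oo)%E)
    (rho_to0 : rho2 a (Gamma n) (sigma2 X (Gamma n)) @[n --> \oo] --> (0 : R))
    (x : nat -> R) (x_ge0 : forall n, 0 <= x n)
    (x_le : forall n, x n ^+ 2 <= 2 * ln ((U a (Gamma n) p)^-1)) :
  (exists2 eps : nat -> R, eps n @[n --> \oo] --> (0 : R) &
     forall n, P [set w | field_sum X (Gamma n) w >= x n * sigma X (Gamma n)] =
       ((1 - Phi (x n)) * (1 + eps n))%:E) /\
  (exists2 eps : nat -> R, eps n @[n --> \oo] --> (0 : R) &
     forall n, P [set w | field_sum X (Gamma n) w <= - x n * sigma X (Gamma n)] =
       ((1 - Phi (x n)) * (1 + eps n))%:E).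
Proof.
have asymp := normalized_tail_asymptotics xi_iid xi0_mean xi0_var X_linear
  sigma_gt0 p_gt2 xi0_Lp rho_to0 x_le.
split.
  have [eps eps0 epsE] := asymp 1 (normr1 _).
  exists eps => // n; rewrite -[RHS]epsE; congr (P _).
  by apply/seteqP; split => w /=; rewrite mul1r ler_pdivlMr.
have [eps eps0 epsE] := asymp (-1) (normrN1 _).
exists eps => // n; rewrite -[RHS]epsE; congr (P _).
by apply/seteqP; split => w /=; rewrite mulN1r lerNr ler_pdivrMr.
Qed.
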